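(* Let $\kappa\ge 0$, let $c=c_\kappa$, and let $(\rho,v,\phi)$ be the peaked solitary wave solution with speed $c_\kappa$ (as defined in the context). Set $\rho^\ast=\sup_{\xi\ne0}\rho$, $v^\ast=\sup_{\xi\ne0}v$, $\phi^\ast=\sup_{\xi\ne0}\phi$. Then the following hold. (1) When $\kappa=0$, $$\lim_{\xi\to0}\frac{\phi^\ast-\phi}{|\xi|^{4/3}}=A_0:=\frac12\left(3\sqrt{\frac{c_0}{2}}\right)^{4/3},\qquad \lim_{\xi\to0}\frac{|\phi'|}{|\xi|^{1/3}}=\frac43A_0,$$ $$\lim_{\xi\to0}|\phi''||\xi|^{2/3}=\frac49A_0=\lim_{\xi\to0}\rho|\xi|^{2/3},\qquad \lim_{\xi\to0}\frac{v^\ast-v}{|\xi|^{2/3}}=\sqrt{2A_0}.$$ (2) When $\kappa>0$, $$\lim_{\xi\to0}\frac{\phi^\ast-\phi}{|\xi|^2}=\lim_{\xi\to0}\frac{|\phi'|}{2|\xi|}=\lim_{\xi\to0}\frac{-\phi''}{2}=\frac12\left(\rho^\ast-e^{\phi^\ast}\right)>0,$$ $$\lim_{\xi\to0}\frac{\rho^\ast-\rho}{|\xi|}=\frac{(\rho^\ast)^2}{c_\kappa}\left(\lim_{\xi\to0}\frac{v^\ast-v}{|\xi|}\right)=\sqrt{\frac{\rho^\ast-e^{\phi^\ast}}{-\frac{dh}{d\rho}(\rho^\ast)}},$$ where $h(\rho)=\frac{c_\kappa^2}{\rho^3}-\frac{\kappa}{\rho}$.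
   Context: Speeds: for $\kappa>0$, $c_\kappa$ is the unique root in $(\sqrt\kappa,\infty)$ of $z^{\kappa}\left[(z-\sqrt\kappa)^2+1\right]=\exp\left((z^2-\kappa)/2\right)\kappa^{\kappa/2}$ (it satisfies $c_\kappa>\sqrt{1+\kappa}$); $c_0>1$ is the unique positive root of $z^2+1=\exp(z^2/2)$. Traveling wave equations with speed $c$ (where $'=d/d\xi$ and $\rho>0$): $$-c\rho'+(\rho v)'=0,\qquad \rho(-cv'+vv')+\kappa\rho'=-\rho\phi',\qquad -\phi''=\rho-e^\phi,$$ with far-field condition $\rho\to1$, $v\to0$, $\phi\to0$ as $\xi\to-\infty$. A peaked solitary wave is a triple $(\rho,v,\phi)(\xi)$ satisfying these equations and the far-field condition for $\xi\in\mathbb R\setminus\{0\}$ in the classical sense, and such that: (i) $\rho(\xi)=\rho(-\xi)$, $v(\xi)=v(-\xi)$, $\phi(\xi)=\phi(-\xi)$ for $\xi\ne0$; (ii) $\rho',v',\phi'>0$ on $(-\infty,0)$; (iii) at $\xi=0$ the right derivative of $(\rho,v)(\xi)$ is not equal to the left derivative. The paper asserts that for $c=c_\kappa$, $\kappa\ge0$, there is a unique peaked solitary wave.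
   Formalization: The formal definition of peaked solitary wave also requires the left and right derivatives of φ at ξ=0 to agree; without it, cutting the wave at an earlier point and reflecting it evenly meets (i)–(iii) but violates the stated limits. *)

(* Defs.v *)
From Stdlib Require Import Reals.
From Coquelicot Require Import Coquelicot.
Open Scope R_scope.

(* [is_c kappa c] says that [c] is the speed c_kappa.  The root is unique in
   the stated range, so the predicate determines [c].  The case kappa = 0 is
   separate because [Rpower 0 0] is not the intended 0^0. *)
Definition is_c (kappa c : R) : Prop :=
  (0 < kappa /\ sqrt kappa < c /\
   Rpower c kappa * ((c - sqrt kappa) ^ 2 + 1)
     = exp ((c ^ 2 - kappa) / 2) * Rpower kappa (kappa / 2))
  \/
  (kappa = 0 /\ 0 < c /\ c ^ 2 + 1 = exp (c ^ 2 / 2)).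

Record traveling_wave_at (kappa c : R) (rho v phi : R -> R) (xi : R) : Prop := {
  tw_pos : 0 < rho xi;
  tw_rho_diff : ex_derive rho xi;
  tw_v_diff : ex_derive v xi;
  tw_phi_diff : ex_derive phi xi;
  tw_phi_diff2 : ex_derive (Derive phi) xi;
  tw_mass :
    - c * Derive rho xi + Derive (fun x => rho x * v x) xi = 0;
  tw_momentum :
    rho xi * (- c * Derive v xi + v xi * Derive v xi) + kappa * Derive rho xi
      = - rho xi * Derive phi xi;
  tw_poisson : - Derive (Derive phi) xi = rho xi - exp (phi xi)
}.

(* The left and right derivatives of [f] at 0 agree.  The value [f 0] carries no
   meaning (for kappa = 0 the density blows up at 0), so one-sided derivatives
   are limits of f', and they may be infinite. *)
Definition derivatives_match_at0 (f : R -> R) : Prop :=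
  exists d : Rbar,
    filterlim (Derive f) (at_left 0) (Rbar_locally d) /\
    filterlim (Derive f) (at_right 0) (Rbar_locally d).

(* [psw_phi_C1]: the corner at 0 is in (rho, v) only; the field -phi' is
   continuous across 0, i.e. Poisson's equation has no point charge there.
   Without this, cutting the increasing half of the wave at any earlier point
   and reflecting it would satisfy all the other conditions, and the wave would
   not be unique. *)
Record peaked_solitary_wave (kappa c : R) (rho v phi : R -> R) : Prop := {
  psw_eqs : forall xi, xi <> 0 -> traveling_wave_at kappa c rho v phi xi;
  psw_far_rho : is_lim rho m_infty 1;
  psw_far_v : is_lim v m_infty 0;
  psw_far_phi : is_lim phi m_infty 0;
  psw_even : forall xi, xi <> 0 ->
    rho xi = rho (- xi) /\ v xi = v (- xi) /\ phi xi = phi (- xi);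
  psw_incr : forall xi, xi < 0 ->
    0 < Derive rho xi /\ 0 < Derive v xi /\ 0 < Derive phi xi;
  psw_corner : ~ (derivatives_match_at0 rho /\ derivatives_match_at0 v);
  psw_phi_C1 : derivatives_match_at0 phi
}.

Definition sup_off0 (f : R -> R) : Rbar :=
  Lub_Rbar (fun y => exists xi, xi <> 0 /\ y = f xi).

Definition A0 (c0 : R) : R := 1 / 2 * Rpower (3 * sqrt (c0 / 2)) (4 / 3).

Definition h (kappa c rho : R) : R := c ^ 2 / rho ^ 3 - kappa / rho.

(* Main.v *)
(* Mass conservation and the Bernoulli law express [v] and [phi] through [rho]:
   [v = c - c / rho] and [phi' = h rho * rho'].  Since [phi'] is odd and has a limit
   at 0, it tends to 0 there, so a corner is possible only if [rho] reaches the zero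
   [c / sqrt kappa] of [h] when [kappa > 0], or blows up when [kappa = 0].
   For [kappa > 0] the equation for c_kappa gives [exp phi* = (c - sqrt kappa)^2 + 1],
   which differs from [rho*]; Poisson's equation then gives the curvature of [phi] at
   the peak, and the quadratic expansion of the Bernoulli law at [rho*] the slope of
   [rho].  For [kappa = 0] the energy integral reads
   [phi'^2 / 2 = exp phi - exp phi* + c sqrt (2 (phi* - phi))], so that
   [u = (phi* - phi)^(1/4)] satisfies [(u^3)' -> - 3/4 sqrt (2 sqrt 2 c)] at 0-. *)

Require Import Defs.
From Stdlib Require Import Reals Lra.
From Coquelicot Require Import Coquelicot.
Open Scope R_scope.

(** Values at 0 carry no information, so estimates are made on the negative half line, with a left
    limit in place of a value, and evenness carries them across 0. For [kappa > 0] the positivity of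
    rho* - exp phi* has two sources. Since phi' is positive on the left and vanishes at the peak,
    the limit of phi'' cannot be positive, which gives the weak inequality. Equality is excluded by
    arithmetic: with t = 1/kappa the speed equation would become (1 + t) ln (1 + t) = t + t^2/2, and
    the right side is strictly larger for t > 0. The gap of phi is then exactly quadratic both in xi
    and in rho* - rho, which forces rho* - rho to be exactly linear. For [kappa = 0] the speed
    equation says exp phi* = c^2 + 1, so the constant terms of the energy cancel at the peak and
    phi'^2 is of order u^2. The derivative of u itself blows up like u^(-2); the cube is the power
    of u with a finite nonzero slope. The far field prescribes nothing for phi', so the constant in
    the energy integral has to be recovered from the convergence of phi alone. *)

(** * Limits at 0, punctured and from the left *)

Lemma is_lim_eq (f : R -> R) (x : Rbar) (a b : R) :
  a = b -> is_lim f x a -> is_lim f x b.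
Proof.
  intros ->. exact (fun H => H).
Qed.

Lemma is_lim_mult_finite (f g : R -> R) (x : Rbar) (a b : R) :
  is_lim f x a -> is_lim g x b -> is_lim (fun y => f y * g y) x (a * b).
Proof.
  intros Hf Hg. exact (is_lim_mult f g x a b Hf Hg I).
Qed.

Lemma is_lim_div_finite (f g : R -> R) (x : Rbar) (a b : R) :
  b <> 0 ->
  is_lim f x a -> is_lim g x b -> is_lim (fun y => f y / g y) x (a / b).
Proof.
  intros Hb Hf Hg. apply (is_lim_div f g x a b Hf Hg).
  - intros E. injection E. exact Hb.
  - exact I.
Qed.

Lemma is_lim_ext_ne0 (f g : R -> R) (l : Rbar) :
  (forall x, x <> 0 -> f x = g x) -> is_lim f 0 l -> is_lim g 0 l.
Proof.
  intros E. apply is_lim_ext_loc. exists (mkposreal 1 Rlt_0_1).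
  intros y _ Hy. exact (E y Hy).
Qed.

Lemma is_lim_at_left (f : R -> R) (l : Rbar) :
  is_lim f 0 l -> filterlim f (at_left 0) (Rbar_locally l).
Proof.
  apply filterlim_filter_le_1. intros P [d Hd]. exists d.
  intros y Hy Hlt. apply Hd; [exact Hy | lra].
Qed.

(** [is_lim] at 0 ignores the point 0, so a left limit and evenness suffice. This reduces every
    two-sided claim to the increasing half of the wave. *)
Lemma is_lim_even_at_left (f : R -> R) (l : Rbar) :
  (forall x, x <> 0 -> f x = f (- x)) ->
  filterlim f (at_left 0) (Rbar_locally l) -> is_lim f 0 l.
Proof.
  intros E H P HP. destruct (H P HP) as [d Hd]. exists d.
  intros y Hy Hne. change (P (f y)).
  destruct (Rlt_or_le y 0) as [Hlt | Hle].
  - exact (Hd y Hy Hlt).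
  - rewrite (E y Hne). apply Hd; [| lra].
    unfold ball in *; simpl in *; unfold AbsRing_ball, abs, minus, plus, opp in *;
      simpl in *.
    replace (- y + - 0) with (- (y + - 0)) by ring. rewrite Rabs_Ropp. exact Hy.
Qed.

Lemma at_left_0_intro (P : R -> Prop) (d : R) :
  0 < d -> (forall y, - d < y < 0 -> P y) -> at_left 0 P.
Proof.
  intros Hd H. exists (mkposreal d Hd). intros y Hy Hlt.
  unfold ball in Hy; simpl in Hy; unfold AbsRing_ball, abs, minus, plus, opp in Hy;
    simpl in Hy.
  apply H. apply Rabs_def2 in Hy. lra.
Qed.

Lemma at_left_0_elim (P : R -> Prop) :
  at_left 0 P -> exists d, 0 < d /\ forall y, - d < y < 0 -> P y.
Proof.
  intros [d Hd]. exists d. split; [apply cond_pos |].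
  intros y Hy. apply Hd; [| lra].
  unfold ball; simpl; unfold AbsRing_ball, abs, minus, plus, opp; simpl.
  apply Rabs_def1; lra.
Qed.

Lemma at_left_0_lim (f : R -> R) (l : R) :
  filterlim f (at_left 0) (Rbar_locally l) <->
  forall eps, 0 < eps ->
    exists d, 0 < d /\ forall y, - d < y < 0 -> Rabs (f y - l) < eps.
Proof.
  split.
  - intros H eps Heps. apply at_left_0_elim.
    apply (H (fun z => Rabs (z - l) < eps)).
    exists (mkposreal eps Heps). intros y Hy. exact Hy.
  - intros H P [eps HP]. destruct (H eps (cond_pos eps)) as [d [Hd Hy]].
    apply (at_left_0_intro _ d Hd). intros y Hyd. apply HP. exact (Hy y Hyd).
Qed.

Lemma at_left_0_lim_plus (f g : R -> R) (a b : R) :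
  filterlim f (at_left 0) (Rbar_locally a) ->
  filterlim g (at_left 0) (Rbar_locally b) ->
  filterlim (fun x => f x + g x) (at_left 0) (Rbar_locally (a + b)).
Proof.
  intros Hf Hg. exact (filterlim_comp_2 _ _ Rplus Hf Hg (filterlim_plus a b)).
Qed.

(** * Taylor estimates at 0 from the left *)

(** The mean value theorem cannot be applied up to 0, where [f] is uncontrolled; it is applied on
    [[x, y]] with [y < 0] close to 0, and the left limit [l] replaces [f 0]. *)
Lemma left_mean_value_bound (f f' : R -> R) (x l M : R) :
  x < 0 ->
  (forall y, x <= y < 0 -> is_derive f y (f' y)) ->
  (forall y, x <= y < 0 -> Rabs (f' y) <= M) ->
  filterlim f (at_left 0) (Rbar_locally l) ->
  Rabs (l - f x) <= M * - x.
Proof.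
  intros Hx Hder Hbd Hlim. apply le_epsilon. intros eps Heps.
  destruct (proj1 (at_left_0_lim f l) Hlim eps Heps) as [d [Hd Hy]].
  (* A point strictly between [x] and 0 that is also within [d] of 0. *)
  set (y := Rmax (x / 2) (- d / 2)).
  assert (Hxy : x < y < 0 /\ - d < y).
  { unfold y, Rmax. destruct (Rle_dec (x / 2) (- d / 2)); lra. }
  destruct (MVT_gen f x y f') as [z [Hz Ez]].
  - intros z Hz. rewrite Rmin_left, Rmax_right in Hz by lra. apply Hder. lra.
  - intros z Hz. rewrite Rmin_left, Rmax_right in Hz by lra.
    apply continuity_pt_filterlim, (ex_derive_continuous f).
    exists (f' z). apply Hder. lra.
  - rewrite Rmin_left, Rmax_right in Hz by lra.
    assert (H1 : Rabs (f y - l) < eps) by (apply Hy; lra).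
    assert (H2 : Rabs (f' z) <= M) by (apply Hbd; lra).
    replace (l - f x) with (- (f y - l) + f' z * (y - x)) by lra.
    eapply Rle_trans; [apply Rabs_triang |].
    rewrite Rabs_Ropp, Rabs_mult, (Rabs_right (y - x)) by lra.
    assert (H3 := Rabs_pos (f' z)).
    assert (Rabs (f' z) * (y - x) <= M * - x) by (apply Rmult_le_compat; lra).
    lra.
Qed.

(** Subtracting the line [a * y] leaves a function with small derivative near 0, to which the mean
    value bound applies. *)
Lemma left_linear_approx (f f' : R -> R) (l a : R) :
  at_left 0 (fun x => is_derive f x (f' x)) ->
  filterlim f (at_left 0) (Rbar_locally l) ->
  filterlim f' (at_left 0) (Rbar_locally a) ->
  filterlim (fun x => (l - f x) / - x) (at_left 0) (Rbar_locally a).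
Proof.
  intros Hder Hf Hf'. apply at_left_0_lim. intros eps Heps.
  destruct (at_left_0_elim _ Hder) as [d1 [Hd1 H1]].
  destruct (proj1 (at_left_0_lim f' a) Hf' (eps / 2)) as [d2 [Hd2 H2]]; [lra |].
  exists (Rmin d1 d2). split; [apply Rmin_pos; assumption |].
  intros x [Hx1 Hx2].
  assert (A1 := Rmin_l d1 d2). assert (A2 := Rmin_r d1 d2).
  assert (B : Rabs (l - (f x - a * x)) <= eps / 2 * - x).
  { apply (left_mean_value_bound (fun y => f y - a * y) (fun y => f' y - a)).
    - exact Hx2.
    - intros y Hy. apply (is_derive_minus f (fun y => a * y)).
      + apply H1. lra.
      + auto_derive; [exact I | ring].
    - intros y Hy. apply Rlt_le, H2. lra.
    - replace l with (l + - (a * 0)) by ring.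
      apply at_left_0_lim_plus; [exact Hf |].
      apply (is_lim_at_left (fun y => - (a * y)) (- (a * 0))).
      apply (is_lim_opp (fun y => a * y) 0 (a * 0)).
      apply (is_lim_scal_l (fun y => y) a 0 0). apply is_lim_id. }
  replace ((l - f x) / - x - a) with ((l - (f x - a * x)) / - x) by (field; lra).
  unfold Rdiv. rewrite Rabs_mult, (Rabs_right (/ - x)).
  - apply Rle_lt_trans with (eps / 2 * - x * / - x).
    + apply Rmult_le_compat_r; [| exact B].
      apply Rlt_le, Rinv_0_lt_compat. lra.
    + replace (eps / 2 * - x * / - x) with (eps / 2) by (field; lra). lra.
  - apply Rle_ge, Rlt_le, Rinv_0_lt_compat. lra.
Qed.

(** Adding [a * y ^ 2] leaves a derivative that is small compared with [- y], so the mean value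
    bound gains a second factor [- x]. *)
Lemma left_quadratic_approx (f f' : R -> R) (l a : R) :
  at_left 0 (fun x => is_derive f x (f' x)) ->
  filterlim f (at_left 0) (Rbar_locally l) ->
  filterlim (fun x => f' x / - x) (at_left 0) (Rbar_locally (2 * a)) ->
  filterlim (fun x => (l - f x) / x ^ 2) (at_left 0) (Rbar_locally a).
Proof.
  intros Hder Hf Hf'. apply at_left_0_lim. intros eps Heps.
  destruct (at_left_0_elim _ Hder) as [d1 [Hd1 H1]].
  destruct (proj1 (at_left_0_lim _ _) Hf' (eps / 2)) as [d2 [Hd2 H2]]; [lra |].
  exists (Rmin d1 d2). split; [apply Rmin_pos; assumption |].
  intros x [Hx1 Hx2].
  assert (A1 := Rmin_l d1 d2). assert (A2 := Rmin_r d1 d2).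
  assert (B : Rabs (l - (f x + a * x ^ 2)) <= eps / 2 * - x * - x).
  { apply (left_mean_value_bound (fun y => f y + a * y ^ 2)
             (fun y => f' y + a * (2 * y))).
    - exact Hx2.
    - intros y Hy. apply (is_derive_plus f (fun y => a * y ^ 2)).
      + apply H1. lra.
      + auto_derive; [exact I | ring].
    - intros y Hy.
      replace (f' y + a * (2 * y)) with ((f' y / - y - 2 * a) * - y)
        by (field; lra).
      rewrite Rabs_mult, (Rabs_right (- y)) by lra.
      apply Rmult_le_compat; [apply Rabs_pos | lra | | lra].
      apply Rlt_le, H2. lra.
    - replace l with (l + a * (0 * 0)) by ring.
      apply at_left_0_lim_plus; [exact Hf |].
      apply (is_lim_at_left (fun y => a * y ^ 2) (a * (0 * 0))).
      apply is_lim_ext with (fun y => a * (y * y)); [intros y; ring |].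
      apply (is_lim_scal_l (fun y => y * y) a 0 (0 * 0)).
      apply is_lim_mult_finite; apply is_lim_id. }
  replace ((l - f x) / x ^ 2 - a) with ((l - (f x + a * x ^ 2)) / x ^ 2)
    by (field; lra).
  assert (0 < x ^ 2) by nra.
  unfold Rdiv. rewrite Rabs_mult, (Rabs_right (/ x ^ 2)).
  - apply Rle_lt_trans with (eps / 2 * - x * - x * / x ^ 2).
    + apply Rmult_le_compat_r; [| exact B].
      apply Rlt_le, Rinv_0_lt_compat. lra.
    + replace (eps / 2 * - x * - x * / x ^ 2) with (eps / 2) by (field; lra). lra.
  - apply Rle_ge, Rlt_le, Rinv_0_lt_compat. lra.
Qed.

(** * Monotone functions on the negative half line and their suprema *)

Lemma increasing_of_Derive_pos (f : R -> R) :
  (forall x, x < 0 -> ex_derive f x) ->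
  (forall x, x < 0 -> 0 < Derive f x) ->
  forall x y, x < y -> y < 0 -> f x < f y.
Proof.
  intros Hd Hp x y Hxy Hy.
  destruct (MVT_gen f x y (Derive f)) as [z [Hz Ez]].
  - intros z Hz. rewrite Rmin_left, Rmax_right in Hz by lra.
    apply Derive_correct, Hd. lra.
  - intros z Hz. rewrite Rmin_left, Rmax_right in Hz by lra.
    apply continuity_pt_filterlim, (ex_derive_continuous f), Hd. lra.
  - rewrite Rmin_left, Rmax_right in Hz by lra.
    assert (0 < Derive f z) by (apply Hp; lra). nra.
Qed.

Lemma Derive_0_constant (f : R -> R) :
  (forall x, x < 0 -> is_derive f x 0) ->
  forall x y, x < 0 -> y < 0 -> f x = f y.
Proof.
  intros Hd x y Hx Hy.
  assert (M : Rmax x y < 0) by (apply Rmax_lub_lt; assumption).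
  destruct (MVT_gen f x y (fun _ => 0)) as [z [_ Ez]].
  - intros z Hz. apply Hd. lra.
  - intros z Hz. apply continuity_pt_filterlim, (ex_derive_continuous f).
    exists 0. apply Hd. lra.
  - lra.
Qed.

Lemma constant_of_Derive_0 (f : R -> R) (l : R) :
  (forall x, x < 0 -> is_derive f x 0) ->
  is_lim f m_infty l ->
  forall x, x < 0 -> f x = l.
Proof.
  intros Hd Hl x Hx.
  assert (E : is_lim (fun _ => f x) m_infty l).
  { apply is_lim_ext_loc with f; [| exact Hl].
    exists 0. intros y Hy. apply Derive_0_constant; assumption. }
  apply is_lim_unique in E. rewrite Lim_const in E. injection E as E. exact E.
Qed.

Lemma increasing_gt_lim (f : R -> R) (l : R) :
  (forall x y, x < y -> y < 0 -> f x < f y) ->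
  is_lim f m_infty l ->
  forall x, x < 0 -> l < f x.
Proof.
  intros Hinc Hl x Hx.
  apply Rle_lt_trans with (f (x - 1)); [| apply Hinc; lra].
  apply (is_lim_le_loc f (fun _ => f (x - 1)) m_infty l (f (x - 1))).
  - exists (x - 1). intros y Hy. apply Rlt_le, Hinc; lra.
  - exact Hl.
  - apply is_lim_const.
Qed.

Lemma increasing_lt_lim (f : R -> R) (l : R) :
  (forall x y, x < y -> y < 0 -> f x < f y) ->
  filterlim f (at_left 0) (Rbar_locally l) ->
  forall x, x < 0 -> f x < l.
Proof.
  intros Hinc Hl x Hx.
  apply Rlt_le_trans with (f (x / 2)); [apply Hinc; lra |].
  apply (filterlim_le (F := at_left 0) (fun _ => f (x / 2)) f (f (x / 2)) l).
  - apply (at_left_0_intro _ (- x / 2)); [lra |].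
    intros y Hy. apply Rlt_le, Hinc; lra.
  - apply filterlim_const.
  - exact Hl.
Qed.

Lemma sup_off0_ge (f : R -> R) (x : R) : x <> 0 -> Rbar_le (f x) (sup_off0 f).
Proof.
  intros Hx. apply (proj1 (Lub_Rbar_correct _)). exists x. split; [exact Hx | reflexivity].
Qed.

Lemma sup_off0_le (f : R -> R) (M : R) :
  (forall x, x <> 0 -> f x <= M) -> Rbar_le (sup_off0 f) M.
Proof.
  intros H. apply (proj2 (Lub_Rbar_correct _)). intros y [x [Hx ->]]. exact (H x Hx).
Qed.

Lemma sup_off0_finite (f : R -> R) (M : R) :
  (forall x, x <> 0 -> f x <= M) -> is_finite (sup_off0 f).
Proof.
  intros H. assert (A := sup_off0_le f M H). assert (B := sup_off0_ge f (-1)).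
  destruct (sup_off0 f); [reflexivity | contradiction |].
  exfalso. apply B. lra.
Qed.

(** Monotone convergence, stated in [Rbar] because the density has an infinite supremum when
    [kappa = 0]. *)
Lemma sup_off0_lim (f : R -> R) :
  (forall x, x <> 0 -> f x = f (- x)) ->
  (forall x y, x < y -> y < 0 -> f x < f y) ->
  is_lim f 0 (sup_off0 f).
Proof.
  intros Hev Hinc.
  (* A point where [f] exceeds [M] can be taken negative, by evenness; monotonicity then extends the
     bound to all points between it and 0. *)
  assert (Happrox : forall M : R, Rbar_lt M (sup_off0 f) ->
            exists x, x < 0 /\ M < f x).
  { intros M HM. apply Classical_Prop.NNPP. intros N.
    apply (Rbar_lt_not_le _ _ HM). apply sup_off0_le. intros x Hx.
    apply Rnot_lt_le. intros Hlt. apply N.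
    destruct (Rlt_or_le x 0) as [Hx0 | Hx0].
    - exists x. split; assumption.
    - exists (- x). rewrite <- Hev by exact Hx. split; [lra | exact Hlt]. }
  assert (Hev' : forall M : R, Rbar_lt M (sup_off0 f) ->
            exists d, 0 < d /\ forall y, - d < y < 0 -> M < f y).
  { intros M HM. destruct (Happrox M HM) as [x [Hx HMx]].
    exists (- x). split; [lra |]. intros y Hy.
    apply Rlt_trans with (f x); [exact HMx | apply Hinc; lra]. }
  apply is_lim_even_at_left; [exact Hev |].
  assert (Hge : forall x, x < 0 -> Rbar_le (f x) (sup_off0 f)).
  { intros x Hx. apply sup_off0_ge. lra. }
  destruct (sup_off0 f) as [s | |].
  - apply at_left_0_lim. intros eps Heps.
    destruct (Hev' (s - eps)) as [d [Hd H]]; [simpl; lra |].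
    exists d. split; [exact Hd |]. intros y Hy.
    assert (A := H y Hy). assert (B := Hge y (proj2 Hy)). simpl in B.
    apply Rabs_def1; lra.
  - intros P [M HM]. destruct (Hev' M I) as [d [Hd H]].
    apply (at_left_0_intro _ d Hd). intros y Hy. apply HM, H, Hy.
  - destruct (Hge (-1)). lra.
Qed.

Lemma is_lim_le_finite (f g : R -> R) (a b : R) :
  (forall x, x <> 0 -> f x <= g x) -> is_lim f 0 a -> is_lim g 0 b -> a <= b.
Proof.
  intros H Hf Hg. apply (is_lim_le_loc f g 0 a b); [| exact Hf | exact Hg].
  exists (mkposreal 1 Rlt_0_1). intros y _ Hy. exact (H y Hy).
Qed.

(** * Derivatives of even functions on the two sides of 0 *)

Lemma Derive_odd (f : R -> R) :
  (forall x, x <> 0 -> ex_derive f x) ->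
  (forall x, x <> 0 -> f x = f (- x)) ->
  forall x, x <> 0 -> Derive f x = - Derive f (- x).
Proof.
  intros Hd Hev x Hx.
  rewrite (Derive_ext_loc f (fun y => f (- y)) x).
  - rewrite (Derive_comp f Ropp).
    + rewrite (Derive_opp (fun y => y)), Derive_id. ring.
    + apply Hd. lra.
    + auto_derive. exact I.
  (* The ball of radius [Rabs x] around [x] misses 0, the only point where evenness may fail. *)
  - assert (Hp : 0 < Rabs x) by (apply Rabs_pos_lt; exact Hx).
    exists (mkposreal _ Hp). intros y Hy. apply Hev. intros ->.
    unfold ball in Hy; simpl in Hy; unfold AbsRing_ball, abs, minus, plus, opp in Hy;
      simpl in Hy.
    rewrite Rplus_0_l, Rabs_Ropp in Hy. lra.
Qed.

Lemma at_right_0_of_odd (f : R -> R) :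
  (forall x, x <> 0 -> f x = - f (- x)) ->
  filterlim f (at_left 0) (Rbar_locally 0) ->
  filterlim f (at_right 0) (Rbar_locally 0).
Proof.
  intros Hodd H P [eps HP].
  destruct (proj1 (at_left_0_lim f 0) H eps (cond_pos eps)) as [d [Hd Hy]].
  exists (mkposreal d Hd). intros y Hb Hpos. apply HP.
  unfold ball in *; simpl in *; unfold AbsRing_ball, abs, minus, plus, opp in *;
    simpl in *.
  apply Rabs_def2 in Hb. rewrite Hodd by lra.
  replace (- f (- y) + - 0) with (- (f (- y) - 0)) by ring.
  rewrite Rabs_Ropp. apply Hy. lra.
Qed.

Lemma derivatives_match_even_flat (f : R -> R) :
  (forall x, x <> 0 -> ex_derive f x) ->
  (forall x, x <> 0 -> f x = f (- x)) ->
  filterlim (Derive f) (at_left 0) (Rbar_locally 0) ->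
  derivatives_match_at0 f.
Proof.
  intros Hd Hev H. exists 0. split; [exact H |].
  apply at_right_0_of_odd; [apply Derive_odd; assumption | exact H].
Qed.

(** The derivative is positive on the left and, being odd, negative on the right, so a common limit
    is both nonnegative and nonpositive. The order on [Rbar] excludes infinite limits at the same
    time. *)
Lemma match_even_incr_flat (f : R -> R) :
  (forall x, x <> 0 -> ex_derive f x) ->
  (forall x, x <> 0 -> f x = f (- x)) ->
  (forall x, x < 0 -> 0 < Derive f x) ->
  derivatives_match_at0 f ->
  filterlim (Derive f) (at_left 0) (Rbar_locally 0).
Proof.
  intros Hd Hev Hpos [d [Hl Hr]].
  replace (Finite 0) with d; [exact Hl |].
  apply Rbar_le_antisym.
  - apply (filterlim_le (F := at_right 0) (Derive f) (fun _ => 0) d 0);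
      [| exact Hr | apply filterlim_const].
    exists (mkposreal 1 Rlt_0_1). intros y _ Hy.
    rewrite (Derive_odd f Hd Hev) by lra.
    assert (0 < Derive f (- y)) by (apply Hpos; lra). lra.
  - apply (filterlim_le (F := at_left 0) (fun _ => 0) (Derive f) 0 d);
      [| apply filterlim_const | exact Hl].
    exists (mkposreal 1 Rlt_0_1). intros y _ Hy. apply Rlt_le, Hpos, Hy.
Qed.

(** * Conservation laws of the wave *)

(** The antiderivative of [h] that vanishes at [r = 1], to match the far field rho = 1, phi = 0. *)
Definition bernoulli (kappa c r : R) : R :=
  c ^ 2 / 2 * (1 - 1 / r ^ 2) - kappa * ln r.

Lemma is_derive_bernoulli (kappa c r : R) :
  0 < r -> is_derive (bernoulli kappa c) r (h kappa c r).
Proof.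
  intros Hr. unfold bernoulli, h. auto_derive.
  - repeat split; [apply Rgt_not_eq; nra | exact Hr].
  - field. lra.
Qed.

Lemma is_derive_h (kappa c r : R) :
  r <> 0 -> is_derive (h kappa c) r (- 3 * c ^ 2 / r ^ 4 + kappa / r ^ 2).
Proof.
  intros Hr. unfold h. auto_derive.
  - repeat split; [| exact Hr].
    repeat apply Rmult_integral_contrapositive_currified; lra.
  - field. exact Hr.
Qed.

Lemma is_c_pos (kappa c : R) : is_c kappa c -> 0 < c.
Proof.
  intros [[Hk [Hc _]] | [_ [Hc _]]]; [| exact Hc].
  assert (A := sqrt_pos kappa). lra.
Qed.

(** The mass equation says that the derivative of this flux is zero; the far field fixes the
    constant on the left, and evenness copies it to the right. *)
Lemma wave_mass (kappa c : R) (rho v phi : R -> R) :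
  peaked_solitary_wave kappa c rho v phi ->
  forall x, x <> 0 -> rho x * (c - v x) = c.
Proof.
  intros W.
  assert (L : forall x, x < 0 -> rho x * (c - v x) = c).
  { apply (constant_of_Derive_0 (fun x => rho x * (c - v x))).
    - intros x Hx. destruct (psw_eqs _ _ _ _ _ W x) as [_ Hr Hv _ _ Hm _ _]; [lra |].
      rewrite Derive_mult in Hm by assumption.
      auto_derive; [repeat split; assumption |].
      rewrite !Rmult_1_l. change (fun x => rho x) with rho.
      change (fun x => v x) with v. lra.
    - replace (Finite c) with (Finite (1 * (c - 0))) by (f_equal; ring).
      apply is_lim_mult_finite; [apply (psw_far_rho _ _ _ _ _ W) |].
      apply is_lim_minus'; [apply is_lim_const | apply (psw_far_v _ _ _ _ _ W)]. }
  intros x Hx. destruct (Rlt_or_le x 0) as [Hlt | Hle]; [exact (L x Hlt) |].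
  destruct (psw_even _ _ _ _ _ W x Hx) as [-> [-> _]]. apply L. lra.
Qed.

Lemma wave_pos (kappa c : R) (rho v phi : R -> R) :
  peaked_solitary_wave kappa c rho v phi -> forall x, x <> 0 -> 0 < rho x.
Proof.
  intros W x Hx. exact (tw_pos _ _ _ _ _ _ (psw_eqs _ _ _ _ _ W x Hx)).
Qed.

Lemma wave_velocity (kappa c : R) (rho v phi : R -> R) :
  peaked_solitary_wave kappa c rho v phi ->
  forall x, x <> 0 -> v x = c - c / rho x.
Proof.
  intros W x Hx. assert (Hr := wave_pos _ _ _ _ _ W x Hx).
  rewrite <- (wave_mass _ _ _ _ _ W x Hx) at 2. field. lra.
Qed.

Lemma wave_Derive_velocity (kappa c : R) (rho v phi : R -> R) :
  peaked_solitary_wave kappa c rho v phi ->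
  forall x, x <> 0 -> Derive v x = c / rho x ^ 2 * Derive rho x.
Proof.
  intros W x Hx. assert (E := wave_velocity _ _ _ _ _ W x Hx).
  destruct (psw_eqs _ _ _ _ _ W x Hx) as [Hp Hr Hv _ _ Hm _ _].
  rewrite Derive_mult in Hm by assumption. rewrite E in Hm.
  apply Rmult_eq_reg_l with (rho x); [| lra].
  replace (rho x * (c / rho x ^ 2 * Derive rho x)) with (c / rho x * Derive rho x)
    by (field; lra).
  lra.
Qed.

Lemma wave_Derive_potential (kappa c : R) (rho v phi : R -> R) :
  peaked_solitary_wave kappa c rho v phi ->
  forall x, x <> 0 -> Derive phi x = h kappa c (rho x) * Derive rho x.
Proof.
  intros W x Hx. assert (E := wave_velocity _ _ _ _ _ W x Hx).
  assert (E' := wave_Derive_velocity _ _ _ _ _ W x Hx).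
  destruct (psw_eqs _ _ _ _ _ W x Hx) as [Hp _ _ _ _ _ Hm _].
  rewrite E, E' in Hm. unfold h.
  apply Rmult_eq_reg_l with (- rho x); [| lra].
  rewrite <- Hm. field. lra.
Qed.

Lemma wave_potential (kappa c : R) (rho v phi : R -> R) :
  peaked_solitary_wave kappa c rho v phi ->
  forall x, x <> 0 -> phi x = bernoulli kappa c (rho x).
Proof.
  intros W.
  assert (L : forall x, x < 0 -> phi x - bernoulli kappa c (rho x) = 0).
  { apply (constant_of_Derive_0 (fun x => phi x - bernoulli kappa c (rho x))).
    - intros x Hx. assert (Hx0 : x <> 0) by lra.
      destruct (psw_eqs _ _ _ _ _ W x Hx0) as [Hp Hr _ Hf _ _ _ _].
      replace 0 with (Derive phi x - Derive rho x * h kappa c (rho x))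
        by (rewrite (wave_Derive_potential _ _ _ _ _ W x Hx0); ring).
      apply (is_derive_minus phi (fun x => bernoulli kappa c (rho x))).
      + apply Derive_correct, Hf.
      + apply (is_derive_comp (bernoulli kappa c) rho).
        * apply is_derive_bernoulli, Hp.
        * apply Derive_correct, Hr.
    - replace 0 with (0 - bernoulli kappa c 1)
        by (unfold bernoulli; rewrite ln_1; field).
      apply is_lim_minus'; [apply (psw_far_phi _ _ _ _ _ W) |].
      apply is_lim_comp_continuous; [apply (psw_far_rho _ _ _ _ _ W) |].
      apply (ex_derive_continuous (bernoulli kappa c)).
      exists (h kappa c 1). apply is_derive_bernoulli. lra. }
  intros x Hx. destruct (Rlt_or_le x 0) as [Hlt | Hle].
  - assert (A := L x Hlt). lra.
  - destruct (psw_even _ _ _ _ _ W x Hx) as [-> [_ ->]].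
    assert (A := L (- x)). lra.
Qed.

Lemma wave_incr (kappa c : R) (rho v phi : R -> R) :
  peaked_solitary_wave kappa c rho v phi ->
  forall x y, x < y -> y < 0 -> rho x < rho y /\ v x < v y /\ phi x < phi y.
Proof.
  intros W x y Hxy Hy.
  assert (D : forall z, z < 0 -> traveling_wave_at kappa c rho v phi z).
  { intros z Hz. apply (psw_eqs _ _ _ _ _ W). lra. }
  assert (P := psw_incr _ _ _ _ _ W).
  repeat split; (apply increasing_of_Derive_pos; [| | exact Hxy | exact Hy]);
    intros z Hz; first [apply (P z Hz) | destruct (D z Hz); assumption].
Qed.

(** * Behaviour at the peak common to all [kappa] *)

Lemma wave_sup_lim (kappa c : R) (rho v phi : R -> R) :
  peaked_solitary_wave kappa c rho v phi ->
  is_lim rho 0 (sup_off0 rho) /\ is_lim v 0 (sup_off0 v) /\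
  is_lim phi 0 (sup_off0 phi).
Proof.
  intros W. assert (I := wave_incr _ _ _ _ _ W).
  assert (E := psw_even _ _ _ _ _ W).
  repeat split; apply sup_off0_lim;
    first [intros x Hx; apply (E x Hx) | intros x y Hxy Hy; apply (I x y Hxy Hy)].
Qed.

Lemma wave_rho_gt_1 (kappa c : R) (rho v phi : R -> R) :
  peaked_solitary_wave kappa c rho v phi -> forall x, x <> 0 -> 1 < rho x.
Proof.
  intros W.
  assert (L : forall x, x < 0 -> 1 < rho x).
  { apply increasing_gt_lim; [| exact (psw_far_rho _ _ _ _ _ W)].
    intros x y Hxy Hy. apply (wave_incr _ _ _ _ _ W x y Hxy Hy). }
  intros x Hx. destruct (Rlt_or_le x 0) as [Hlt | Hle]; [exact (L x Hlt) |].
  destruct (psw_even _ _ _ _ _ W x Hx) as [-> _]. apply L. lra.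
Qed.

(** On the left [h] is the quotient of the positive derivatives of [phi] and [rho]. For [kappa > 0]
    this keeps the density strictly below the zero of [h]. *)
Lemma wave_h_pos (kappa c : R) (rho v phi : R -> R) :
  peaked_solitary_wave kappa c rho v phi ->
  forall x, x <> 0 -> 0 < h kappa c (rho x).
Proof.
  intros W.
  assert (L : forall x, x < 0 -> 0 < h kappa c (rho x)).
  { intros x Hx. destruct (psw_incr _ _ _ _ _ W x Hx) as [Hr [_ Hp]].
    rewrite (wave_Derive_potential _ _ _ _ _ W) in Hp by lra.
    apply Rmult_lt_reg_r with (Derive rho x); [exact Hr |]. lra. }
  intros x Hx. destruct (Rlt_or_le x 0) as [Hlt | Hle]; [exact (L x Hlt) |].
  destruct (psw_even _ _ _ _ _ W x Hx) as [-> _]. apply L. lra.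
Qed.

Lemma wave_sup_finite (kappa c : R) (rho v phi : R -> R) :
  0 <= kappa -> 0 < c -> peaked_solitary_wave kappa c rho v phi ->
  is_finite (sup_off0 v) /\ is_finite (sup_off0 phi).
Proof.
  intros Hk Hc W. assert (R1 := wave_rho_gt_1 _ _ _ _ _ W). split.
  - apply (sup_off0_finite v c). intros x Hx.
    rewrite (wave_velocity _ _ _ _ _ W x Hx).
    assert (0 < c / rho x) by (apply Rdiv_lt_0_compat; specialize (R1 x Hx); lra).
    lra.
  - apply (sup_off0_finite phi (c ^ 2 / 2)). intros x Hx.
    rewrite (wave_potential _ _ _ _ _ W x Hx). specialize (R1 x Hx).
    unfold bernoulli.
    assert (0 < ln (rho x)) by (rewrite <- ln_1; apply ln_increasing; lra).
    assert (0 < 1 / rho x ^ 2) by (apply Rdiv_lt_0_compat; nra).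
    assert (0 <= kappa * ln (rho x)) by (apply Rmult_le_pos; lra).
    assert (0 < c ^ 2) by nra. nra.
Qed.

Lemma wave_Derive_potential_vanishes (kappa c : R) (rho v phi : R -> R) :
  peaked_solitary_wave kappa c rho v phi ->
  filterlim (Derive phi) (at_left 0) (Rbar_locally 0).
Proof.
  intros W. apply match_even_incr_flat.
  - intros x Hx. apply (psw_eqs _ _ _ _ _ W x Hx).
  - intros x Hx. apply (psw_even _ _ _ _ _ W x Hx).
  - intros x Hx. apply (psw_incr _ _ _ _ _ W x Hx).
  - apply (psw_phi_C1 _ _ _ _ _ W).
Qed.

Lemma wave_Rabs_Derive_potential_even (kappa c : R) (rho v phi : R -> R) :
  peaked_solitary_wave kappa c rho v phi ->
  forall x, x <> 0 -> Rabs (Derive phi x) = Rabs (Derive phi (- x)).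
Proof.
  intros W x Hx. rewrite (Derive_odd phi) with (x := x); [apply Rabs_Ropp | | | exact Hx].
  - intros y Hy. apply (psw_eqs _ _ _ _ _ W y Hy).
  - intros y Hy. apply (psw_even _ _ _ _ _ W y Hy).
Qed.

(* If the density had a finite limit where [h] does not vanish, then
   [rho' = phi' / h rho] and [v' = c rho' / rho ^ 2] would vanish at 0 together
   with [phi'], and the wave would have no corner. *)
Lemma wave_critical_at_peak (kappa c r : R) (rho v phi : R -> R) :
  peaked_solitary_wave kappa c rho v phi ->
  sup_off0 rho = Finite r -> 0 < r /\ h kappa c r = 0.
Proof.
  intros W Er.
  destruct (wave_sup_lim _ _ _ _ _ W) as [Lr _]. rewrite Er in Lr.
  assert (R1 : 1 <= r).
  { apply (is_lim_le_finite (fun _ => 1) rho); [| apply is_lim_const | exact Lr].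
    intros x Hx. apply Rlt_le, (wave_rho_gt_1 _ _ _ _ _ W x Hx). }
  split; [lra |].
  assert (Hcont : is_lim (fun x => h kappa c (rho x)) 0 (h kappa c r)).
  { apply is_lim_comp_continuous; [exact Lr |].
    apply (ex_derive_continuous (h kappa c)).
    eexists. apply is_derive_h. lra. }
  apply Classical_Prop.NNPP. intros Hne.
  apply (psw_corner _ _ _ _ _ W).
  (* The absolute value makes the odd function phi' even, so that a two-sided limit is available; on
     the left it changes nothing. *)
  assert (Dphi : is_lim (fun x => Rabs (Derive phi x)) 0 0).
  { apply is_lim_even_at_left; [apply (wave_Rabs_Derive_potential_even _ _ _ _ _ W) |].
    replace (Finite 0) with (Rbar_abs 0) by (simpl; rewrite Rabs_R0; reflexivity).
    eapply filterlim_comp; [apply (wave_Derive_potential_vanishes _ _ _ _ _ W) |].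
    apply (filterlim_Rabs 0). }
  assert (Drho : is_lim (fun x => Rabs (Derive phi x) / h kappa c (rho x)) 0 0).
  { apply (is_lim_eq _ _ (0 / h kappa c r)); [field; exact Hne |].
    apply is_lim_div_finite; assumption. }
  assert (Dv : is_lim (fun x => c / rho x ^ 2 *
                 (Rabs (Derive phi x) / h kappa c (rho x))) 0 0).
  { apply (is_lim_eq _ _ (c / r ^ 2 * 0)); [ring |].
    apply is_lim_mult_finite; [| exact Drho].
    apply (is_lim_comp_continuous rho (fun y => c / y ^ 2)); [exact Lr |].
    apply (ex_derive_continuous (fun y => c / y ^ 2)). auto_derive.
    apply Rgt_not_eq. nra. }
  assert (Eq : forall x, x < 0 ->
            Rabs (Derive phi x) / h kappa c (rho x) = Derive rho x).
  { intros x Hx. assert (Hh := wave_h_pos _ _ _ _ _ W x).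
    rewrite Rabs_right by (apply Rle_ge, Rlt_le, (psw_incr _ _ _ _ _ W x Hx)).
    rewrite (wave_Derive_potential _ _ _ _ _ W) by lra. field. lra. }
  split; apply derivatives_match_even_flat.
  - intros x Hx. apply (psw_eqs _ _ _ _ _ W x Hx).
  - intros x Hx. apply (psw_even _ _ _ _ _ W x Hx).
  - apply filterlim_within_ext with (2 := is_lim_at_left _ _ Drho). exact Eq.
  - intros x Hx. apply (psw_eqs _ _ _ _ _ W x Hx).
  - intros x Hx. apply (psw_even _ _ _ _ _ W x Hx).
  - apply filterlim_within_ext with (2 := is_lim_at_left _ _ Dv).
    intros x Hx. rewrite (Eq x Hx).
    symmetry. apply (wave_Derive_velocity _ _ _ _ _ W). lra.
Qed.

(** * Consequences of the speed equation for [kappa > 0] *)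

(** The difference of the two sides vanishes at 0 and has derivative [t - ln (1 + t)], which is
    positive. *)
Lemma mul_ln_1p_lt (t : R) : 0 < t -> (1 + t) * ln (1 + t) < t + t ^ 2 / 2.
Proof.
  intros Ht.
  destruct (MVT_cor2 (fun x => x + x ^ 2 / 2 - (1 + x) * ln (1 + x))
              (fun x => x - ln (1 + x)) 0 t Ht) as [z [Ez Hz]].
  - intros x Hx. apply is_derive_Reals. auto_derive; [lra | field; lra].
  - assert (A : ln (1 + z) < z).
    { rewrite <- (ln_exp z) at 2. apply ln_increasing; [lra |].
      apply exp_ineq1. lra. }
    assert (B : 0 < (z - ln (1 + z)) * (t - 0)) by (apply Rmult_lt_0_compat; lra).
    rewrite <- Ez in B. rewrite Rplus_0_r, ln_1 in B.
    lra.
Qed.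

Lemma is_c_log (kappa c : R) :
  0 < kappa -> is_c kappa c ->
  kappa * ln c + ln ((c - sqrt kappa) ^ 2 + 1)
    = (c ^ 2 - kappa) / 2 + kappa * ln (sqrt kappa).
Proof.
  intros Hk Hc. destruct Hc as [[_ [_ E]] | [E _]]; [| lra].
  assert (Hs : 0 < sqrt kappa) by (apply sqrt_lt_R0; exact Hk).
  apply (f_equal ln) in E. unfold Rpower in E.
  assert (A := pow2_ge_0 (c - sqrt kappa)).
  assert (0 < (c - sqrt kappa) ^ 2 + 1) by lra.
  rewrite !ln_mult, !ln_exp in E; try apply exp_pos; try assumption.
  rewrite E. f_equal.
  rewrite <- (sqrt_sqrt kappa) at 2 by lra. rewrite ln_mult by exact Hs. field.
Qed.

(** At [r = c / sqrt kappa] the Bernoulli function is (c^2 - kappa)/2 - kappa ln (c / sqrt kappa),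
    and the logarithm of the speed equation evaluates exactly this. The right side is also what the
    energy integral demands of exp phi at that density when phi' = 0. *)
Lemma is_c_exp_peak (kappa c : R) :
  0 < kappa -> is_c kappa c ->
  exp (bernoulli kappa c (c / sqrt kappa)) = (c - sqrt kappa) ^ 2 + 1.
Proof.
  intros Hk Hc. assert (E := is_c_log kappa c Hk Hc).
  assert (Hcp := is_c_pos kappa c Hc).
  assert (Hs : 0 < sqrt kappa) by (apply sqrt_lt_R0; exact Hk).
  assert (Hss := sqrt_sqrt kappa (Rlt_le _ _ Hk)).
  assert (A := pow2_ge_0 (c - sqrt kappa)).
  rewrite <- (exp_ln ((c - sqrt kappa) ^ 2 + 1)) by lra. f_equal.
  unfold bernoulli. rewrite ln_div by assumption.
  replace (c ^ 2 / 2 * (1 - 1 / (c / sqrt kappa) ^ 2)) with ((c ^ 2 - kappa) / 2).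
  - lra.
  - rewrite <- Hss at 1. field. lra.
Qed.

(* [c = s + 1 / s] with [s = sqrt kappa] is exactly the case of equality
   [rho* = exp phi*]. *)
Lemma is_c_peak_ne (kappa c : R) :
  0 < kappa -> is_c kappa c -> sqrt kappa * (c - sqrt kappa) <> 1.
Proof.
  intros Hk Hc N. assert (E := is_c_log kappa c Hk Hc).
  assert (Hs : 0 < sqrt kappa) by (apply sqrt_lt_R0; exact Hk).
  assert (Hss := sqrt_sqrt kappa (Rlt_le _ _ Hk)).
  set (s := sqrt kappa) in *.
  assert (Ht : 0 < / kappa) by (apply Rinv_0_lt_compat, Hk).
  assert (Hkt : kappa * / kappa = 1) by (field; lra).
  assert (Ecs : (c - s) ^ 2 = / kappa).
  { apply Rmult_eq_reg_l with kappa; [| lra]. rewrite Hkt, <- Hss.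
    replace (s * s * (c - s) ^ 2) with ((s * (c - s)) ^ 2) by ring.
    rewrite N. ring. }
  assert (Ec : c = s * (1 + / kappa)).
  { rewrite <- Hss. apply Rmult_eq_reg_l with s; [| lra].
    replace (s * (s * (1 + / (s * s)))) with (s * s + 1) by (field; lra). lra. }
  assert (Ec2 : c ^ 2 - kappa = 2 + / kappa).
  { replace (c ^ 2) with ((c - s) ^ 2 + 2 * (s * (c - s)) + s * s) by ring.
    rewrite Ecs, N, Hss. ring. }
  rewrite Ecs, Ec2, Ec, ln_mult in E by lra.
  rewrite (Rplus_comm (/ kappa) 1) in E.
  assert (A := mul_ln_1p_lt (/ kappa) Ht).
  (* The terms [kappa * ln s] cancel. Multiplied by [/ kappa], this is equality in [mul_ln_1p_lt] at
     [/ kappa]. *)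
  assert (B : (kappa + 1) * ln (1 + / kappa) = 1 + / kappa / 2) by lra.
  apply (f_equal (fun z => / kappa * z)) in B.
  replace (/ kappa * ((kappa + 1) * ln (1 + / kappa)))
    with ((1 + / kappa) * ln (1 + / kappa)) in B by (field; lra).
  nra.
Qed.

(** * Expansion at the peak for [kappa > 0] *)

Lemma wave_poisson_lim (kappa c : R) (rho v phi : R -> R) (r p : R) :
  peaked_solitary_wave kappa c rho v phi ->
  is_lim rho 0 r -> is_lim phi 0 p ->
  is_lim (Derive (Derive phi)) 0 (exp p - r).
Proof.
  intros W Hr Hp.
  apply is_lim_ext_ne0 with (fun x => exp (phi x) - rho x).
  - intros x Hx. assert (E := tw_poisson _ _ _ _ _ _ (psw_eqs _ _ _ _ _ W x Hx)). lra.
  - apply is_lim_minus'; [| exact Hr].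
    apply is_lim_comp_continuous; [exact Hp | apply continuous_exp].
Qed.

Lemma is_lim_even_of_left (f g : R -> R) (l : R) :
  (forall x, x <> 0 -> f x = f (- x)) ->
  (forall x, x < 0 -> g x = f x) ->
  filterlim g (at_left 0) (Rbar_locally l) -> is_lim f 0 l.
Proof.
  intros Hev E H. apply is_lim_even_at_left; [exact Hev |].
  exact (filterlim_within_ext _ _ _ E H).
Qed.

Lemma at_left_0_of_neg (P : R -> Prop) : (forall x, x < 0 -> P x) -> at_left 0 P.
Proof.
  intros H. apply (at_left_0_intro P 1 Rlt_0_1). intros y Hy. apply H, Hy.
Qed.

(** The field phi' tends to 0 at the peak, so its linear approximation from the left has slope given
    by the limit of phi''. *)
Lemma wave_slope_lim (kappa c : R) (rho v phi : R -> R) (L : R) :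
  peaked_solitary_wave kappa c rho v phi ->
  is_lim (Derive (Derive phi)) 0 (- (2 * L)) ->
  is_lim (fun x => Rabs (Derive phi x) / Rabs x) 0 (2 * L).
Proof.
  intros W H. apply is_lim_even_of_left
    with (fun x => - ((0 - Derive phi x) / - x)).
  - intros x Hx. rewrite Rabs_Ropp.
    rewrite (wave_Rabs_Derive_potential_even _ _ _ _ _ W x Hx). reflexivity.
  - intros x Hx. destruct (psw_incr _ _ _ _ _ W x Hx) as [_ [_ Hp]].
    rewrite Rabs_right, Rabs_left by lra. field. lra.
  - replace (Finite (2 * L)) with (Rbar_opp (- (2 * L))) by (simpl; f_equal; ring).
    eapply filterlim_comp; [| apply filterlim_Rbar_opp].
    apply left_linear_approx with (Derive (Derive phi)).
    + apply at_left_0_of_neg. intros x Hx. apply Derive_correct.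
      apply (psw_eqs _ _ _ _ _ W x). lra.
    + apply (wave_Derive_potential_vanishes _ _ _ _ _ W).
    + apply is_lim_at_left, H.
Qed.

Lemma wave_potential_quadratic (kappa c : R) (rho v phi : R -> R) (p L : R) :
  peaked_solitary_wave kappa c rho v phi ->
  is_lim phi 0 p ->
  is_lim (fun x => Rabs (Derive phi x) / Rabs x) 0 (2 * L) ->
  is_lim (fun x => (p - phi x) / Rabs x ^ 2) 0 L.
Proof.
  intros W Hp H. apply is_lim_even_of_left with (fun x => (p - phi x) / x ^ 2).
  - intros x Hx. rewrite Rabs_Ropp.
    destruct (psw_even _ _ _ _ _ W x Hx) as [_ [_ <-]]. reflexivity.
  - intros x Hx. rewrite pow2_abs. reflexivity.
  - apply left_quadratic_approx with (Derive phi).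
    + apply at_left_0_of_neg. intros x Hx. apply Derive_correct.
      apply (psw_eqs _ _ _ _ _ W x). lra.
    + apply is_lim_at_left, Hp.
    + apply filterlim_within_ext with (2 := is_lim_at_left _ _ H).
      intros x Hx. destruct (psw_incr _ _ _ _ _ W x Hx) as [_ [_ Hd]].
      rewrite Rabs_right, Rabs_left by lra. reflexivity.
Qed.

(** The linear term is absent because [h] vanishes at [r]. Only [y < 0] is needed, since the density
    stays below its peak value. *)
Lemma bernoulli_quadratic (kappa c r : R) :
  0 < r -> h kappa c r = 0 ->
  filterlim (fun y => (bernoulli kappa c r - bernoulli kappa c (r + y)) / y ^ 2)
    (at_left 0) (Rbar_locally (- Derive (h kappa c) r / 2)).
Proof.
  intros Hr Hh.
  assert (Hshift : forall z y, is_derive (fun y => z + y) y 1).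
  { intros z y. auto_derive; [exact I | reflexivity]. }
  assert (Hd : ex_derive (h kappa c) r) by (eexists; apply is_derive_h; lra).
  apply left_quadratic_approx with (fun y => h kappa c (r + y)).
  - apply (at_left_0_intro _ r Hr). intros y Hy.
    replace (h kappa c (r + y)) with (scal 1 (h kappa c (r + y)))
      by (unfold scal; simpl; unfold mult; simpl; ring).
    apply (is_derive_comp (bernoulli kappa c) (fun y => r + y)); [| apply Hshift].
    apply is_derive_bernoulli. lra.
  - apply (is_lim_at_left _ (bernoulli kappa c r)).
    apply (is_lim_comp_continuous (fun y => r + y)).
    + apply (is_lim_eq _ _ (r + 0)); [ring |].
      apply is_lim_plus'; [apply is_lim_const | apply is_lim_id].
    + apply (ex_derive_continuous (bernoulli kappa c)).
      eexists. apply is_derive_bernoulli, Hr.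
  - apply Derive_correct, is_derive_Reals in Hd.
    apply at_left_0_lim. intros eps Heps.
    destruct (Hd eps Heps) as [d Hd']. exists d. split; [apply cond_pos |].
    intros y Hy. specialize (Hd' y). rewrite Hh in Hd'.
    replace (h kappa c (r + y) / - y - 2 * (- Derive (h kappa c) r / 2))
      with (- ((h kappa c (r + y) - 0) / y - Derive (h kappa c) r)) by (field; lra).
    rewrite Rabs_Ropp. apply Hd'; [lra |]. apply Rabs_def1; lra.
Qed.

(** The gap of [phi] is compared with xi^2 through Poisson's equation and with the squared gap of
    [rho] through the Bernoulli function. The quotient of the two comparisons is the square of the
    slope of [rho]. *)
Lemma peaked_wave_pressure (kappa c : R) (rho v phi : R -> R) :
  0 < kappa -> is_c kappa c -> peaked_solitary_wave kappa c rho v phi ->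
    is_finite (sup_off0 rho) /\
    is_finite (sup_off0 v) /\
    is_finite (sup_off0 phi) /\
    let rhos := real (sup_off0 rho) in
    let vs := real (sup_off0 v) in
    let phis := real (sup_off0 phi) in
    let L := 1 / 2 * (rhos - exp phis) in
    let S := sqrt ((rhos - exp phis) / - Derive (h kappa c) rhos) in
    is_lim (fun xi => (phis - phi xi) / Rabs xi ^ 2) 0 L /\
    is_lim (fun xi => Rabs (Derive phi xi) / (2 * Rabs xi)) 0 L /\
    is_lim (fun xi => - Derive (Derive phi) xi / 2) 0 L /\
    0 < L /\
    Derive (h kappa c) rhos < 0 /\
    is_lim (fun xi => (rhos - rho xi) / Rabs xi) 0 S /\
    exists Lv : R,
      is_lim (fun xi => (vs - v xi) / Rabs xi) 0 Lv /\
      rhos ^ 2 / c * Lv = S.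
Proof.
  intros Hk Hc W.
  assert (Hcp := is_c_pos kappa c Hc).
  assert (Hs : 0 < sqrt kappa) by (apply sqrt_lt_R0; exact Hk).
  assert (Hss := sqrt_sqrt kappa (Rlt_le _ _ Hk)).
  destruct (wave_sup_finite kappa c rho v phi (Rlt_le _ _ Hk) Hcp W) as [Fv Fp].
  destruct (wave_sup_lim _ _ _ _ _ W) as [Lr [Lv Lp]].
  assert (Hlt : forall x, x <> 0 -> rho x < c / sqrt kappa).
  { intros x Hx. assert (A := wave_h_pos _ _ _ _ _ W x Hx).
    assert (P := wave_pos _ _ _ _ _ W x Hx). unfold h in A.
    assert (B : 0 < c ^ 2 - kappa * rho x ^ 2).
    { replace (c ^ 2 - kappa * rho x ^ 2)
        with ((c ^ 2 / rho x ^ 3 - kappa / rho x) * rho x ^ 3) by (field; lra).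
      apply Rmult_lt_0_compat; [exact A | apply pow_lt, P]. }
    apply Rmult_lt_reg_r with (sqrt kappa); [exact Hs |].
    replace (c / sqrt kappa * sqrt kappa) with c by (field; lra).
    apply Rnot_le_lt. intros N.
    assert (c * c <= rho x * sqrt kappa * (rho x * sqrt kappa))
      by (apply Rmult_le_compat; lra).
    nra. }
  assert (Fr : is_finite (sup_off0 rho)).
  { apply (sup_off0_finite rho (c / sqrt kappa)).
    intros x Hx. apply Rlt_le, Hlt, Hx. }
  split; [exact Fr | split; [exact Fv | split; [exact Fp |]]].
  rewrite <- Fr in Lr. rewrite <- Fv in Lv. rewrite <- Fp in Lp.
  destruct (wave_critical_at_peak _ _ (real (sup_off0 rho)) _ _ _ W (eq_sym Fr))
    as [Hr Hh].
  revert Lr Lv Lp Hr Hh.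
  generalize (real (sup_off0 rho)) (real (sup_off0 v)) (real (sup_off0 phi)).
  clear Fr Fv Fp. intros r vs p Lr Lv Lp Hr Hh. cbv zeta.
  assert (Hrk : kappa * r ^ 2 = c ^ 2).
  { unfold h in Hh.
    assert (B : (c ^ 2 / r ^ 3 - kappa / r) * r ^ 3 = 0) by (rewrite Hh; ring).
    replace ((c ^ 2 / r ^ 3 - kappa / r) * r ^ 3) with (c ^ 2 - kappa * r ^ 2) in B
      by (field; lra). lra. }
  (* The upper bound [c / sqrt kappa] is thus the supremum itself, and [Hlt] becomes the strict
     inequality [rho x < r] used for division below. *)
  assert (Er : r = c / sqrt kappa).
  { apply Rmult_eq_reg_r with (sqrt kappa); [| lra].
    replace (c / sqrt kappa * sqrt kappa) with c by (field; lra).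
    assert (0 < r * sqrt kappa) by (apply Rmult_lt_0_compat; assumption). nra. }
  assert (Hlt' : forall x, x <> 0 -> rho x < r) by (rewrite Er; exact Hlt).
  assert (Hev := psw_even _ _ _ _ _ W).
  assert (Hpos := wave_pos _ _ _ _ _ W).
  assert (Ep : p = bernoulli kappa c r).
  { assert (A : is_lim phi 0 (bernoulli kappa c r)).
    { apply is_lim_ext_ne0 with (fun x => bernoulli kappa c (rho x)).
      - intros x Hx. symmetry. apply (wave_potential _ _ _ _ _ W x Hx).
      - apply is_lim_comp_continuous; [exact Lr |].
        apply (ex_derive_continuous (bernoulli kappa c)).
        eexists. apply is_derive_bernoulli, Hr. }
    apply is_lim_unique in A. apply is_lim_unique in Lp. rewrite A in Lp.
    injection Lp. intros ->. reflexivity. }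
  set (L := 1 / 2 * (r - exp p)).
  assert (Hphi2 : is_lim (Derive (Derive phi)) 0 (- (2 * L))).
  { apply (is_lim_eq _ _ (exp p - r)); [unfold L; field |].
    apply (wave_poisson_lim _ _ _ _ _ _ _ W Lr Lp). }
  assert (Hphi1 := wave_slope_lim _ _ _ _ _ _ W Hphi2).
  assert (Hphi0 := wave_potential_quadratic _ _ _ _ _ _ _ W Lp Hphi1).
  assert (HL : 0 < L).
  { assert (A : 0 <= 2 * L).
    { apply (is_lim_le_finite (fun _ => 0) (fun x => Rabs (Derive phi x) / Rabs x));
        [| apply is_lim_const | exact Hphi1].
      intros x Hx. apply Rle_div_r; [apply Rlt_gt, Rabs_pos_lt, Hx |].
      rewrite Rmult_0_l. apply Rabs_pos. }
    assert (B : r <> exp p).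
    { rewrite Ep, Er. rewrite (is_c_exp_peak kappa c Hk Hc). intros N.
      apply (f_equal (fun z => z * sqrt kappa)) in N.
      replace (c / sqrt kappa * sqrt kappa) with c in N by (field; lra).
      (* With s = [sqrt kappa], [N] reads c = s ((c - s)^2 + 1), that is c - s = s (c - s)^2;
         cancelling c - s gives the excluded equality. *)
      assert (Hc1 : c - sqrt kappa <> 0).
      { destruct Hc as [[_ [Hc1 _]] | [Hc1 _]]; lra. }
      apply (is_c_peak_ne kappa c Hk Hc).
      apply Rmult_eq_reg_l with (c - sqrt kappa); [| exact Hc1].
      lra. }
    unfold L in *. lra. }
  assert (Hdh : Derive (h kappa c) r < 0).
  { rewrite (is_derive_unique _ _ _ (is_derive_h kappa c r (Rgt_not_eq _ _ Hr))).
    (* At the zero of [h], c^2 = kappa r^2, so the first term is -3 kappa / r^2. *)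
    replace (-3 * c ^ 2 / r ^ 4 + kappa / r ^ 2) with (- (2 * kappa / r ^ 2)).
    - apply Ropp_lt_gt_0_contravar, Rdiv_lt_0_compat; [lra | apply pow_lt, Hr].
    - rewrite <- Hrk. field. lra. }
  set (D := Derive (h kappa c) r) in *.
  assert (Hrho : is_lim (fun x => (r - rho x) / Rabs x) 0 (sqrt ((r - exp p) / - D))).
  { assert (Hq : filterlim (fun x => (p - phi x) / (r - rho x) ^ 2)
                   (at_left 0) (Rbar_locally (- D / 2))).
    { apply filterlim_within_ext with (f := fun x =>
        (fun y => (bernoulli kappa c r - bernoulli kappa c (r + y)) / y ^ 2)
          (rho x - r)).
      - intros x Hx. cbv beta. rewrite <- Ep.
        replace (r + (rho x - r)) with (rho x) by ring.
        rewrite <- (wave_potential _ _ _ _ _ W) by lra.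
        replace ((rho x - r) ^ 2) with ((r - rho x) ^ 2) by ring. reflexivity.
      (* The change of variable [y = rho x - r] tends to 0 through negative values because
         [rho x < r] is strict. *)
      - refine (filterlim_comp _ _ _ (fun x => rho x - r) _ _ (at_left 0) _ _
                  (bernoulli_quadratic kappa c r Hr Hh)).
        intros P HP. destruct (at_left_0_elim _ HP) as [d [Hd HPd]].
        destruct (proj1 (at_left_0_lim rho r) (is_lim_at_left _ _ Lr) d Hd)
          as [e [He Hy]].
        apply (at_left_0_intro _ e He). intros y Hye. apply HPd.
        assert (A := Hlt' y). assert (B := Hy y Hye). apply Rabs_def2 in B. lra. }
    assert (Hq' : is_lim (fun x => (p - phi x) / (r - rho x) ^ 2) 0 (- D / 2)).
    { apply is_lim_even_at_left; [| exact Hq].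
      intros x Hx. destruct (Hev x Hx) as [<- [_ <-]]. reflexivity. }
    apply is_lim_ext_ne0 with (fun x => sqrt
      ((p - phi x) / Rabs x ^ 2 / ((p - phi x) / (r - rho x) ^ 2))).
    - intros x Hx. assert (A := Hlt' x Hx).
      assert (Ha : 0 < Rabs x) by (apply Rabs_pos_lt, Hx).
      assert (Hpp : p - phi x <> 0).
      { assert (Hinc := wave_incr _ _ _ _ _ W).
        assert (G : forall y, y < 0 -> phi y < p).
        { apply increasing_lt_lim; [apply Hinc | apply is_lim_at_left, Lp]. }
        destruct (Rlt_or_le x 0) as [Hx0 | Hx0].
        - specialize (G x Hx0). lra.
        - destruct (Hev x Hx) as [_ [_ ->]]. specialize (G (- x)). lra. }
      rewrite <- (sqrt_pow2 ((r - rho x) / Rabs x)).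
      + f_equal. field. repeat split; lra.
      + apply Rlt_le, Rdiv_lt_0_compat; lra.
    - apply (is_lim_comp_continuous _ sqrt); [| apply continuous_sqrt].
      apply (is_lim_eq _ _ (L / (- D / 2))); [unfold L; field; lra |].
      apply is_lim_div_finite; [lra | exact Hphi0 | exact Hq']. }
  repeat split.
  - exact Hphi0.
  - apply is_lim_ext_ne0 with (fun x => / 2 * (Rabs (Derive phi x) / Rabs x)).
    + intros x Hx. field. apply Rabs_no_R0, Hx.
    + apply (is_lim_eq _ _ (/ 2 * (2 * L))); [field |].
      apply is_lim_mult_finite; [apply is_lim_const | exact Hphi1].
  - apply is_lim_ext with (fun x => - / 2 * Derive (Derive phi) x); [intros x; field |].
    apply (is_lim_eq _ _ (- / 2 * - (2 * L))); [field |].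
    apply is_lim_mult_finite; [apply is_lim_const | exact Hphi2].
  - exact HL.
  - exact Hdh.
  - exact Hrho.
  - set (S := sqrt ((r - exp p) / - D)) in *.
    (* From v = c - c / rho the velocity gap equals c (r - rho) / (r rho), whose prefactor tends to
       c / r^2. *)
    exists (c / (r * r) * S). split; [| field; lra].
    assert (Ev : vs = c - c / r).
    { assert (A : is_lim v 0 (c - c / r)).
      { apply is_lim_ext_ne0 with (fun x => c - c / rho x).
        - intros x Hx. symmetry. apply (wave_velocity _ _ _ _ _ W x Hx).
        - apply is_lim_minus'; [apply is_lim_const |].
          apply is_lim_div_finite; [lra | apply is_lim_const | exact Lr]. }
      apply is_lim_unique in A. apply is_lim_unique in Lv. rewrite A in Lv.
      injection Lv. intros ->. reflexivity. }
    apply is_lim_ext_ne0 with (fun x => c / (r * rho x) * ((r - rho x) / Rabs x)).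
    + intros x Hx. assert (A := Hpos x Hx). rewrite Ev, (wave_velocity _ _ _ _ _ W x Hx).
      field. repeat split; first [lra | apply Rabs_no_R0, Hx].
    + apply is_lim_mult_finite; [| exact Hrho].
      apply is_lim_div_finite; [nra | apply is_lim_const |].
      apply is_lim_mult_finite; [apply is_lim_const | exact Lr].
Qed.

(** * The energy integral *)

(** If [M] were positive, increments of [f] over unit intervals far to the left would stay away from
    0, against convergence. The square appears because the energy identity controls only phi'^2. *)
Lemma Derive_sq_lim_m_infty (f : R -> R) (l M : R) :
  (forall x, x < 0 -> ex_derive f x) ->
  is_lim f m_infty l ->
  is_lim (fun x => Derive f x ^ 2) m_infty M ->
  M = 0.
Proof.
  intros Hd Hl HM.
  assert (HM0 : 0 <= M).
  { apply (is_lim_le_loc (fun _ => 0) (fun x => Derive f x ^ 2) m_infty 0 M);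
      [| apply is_lim_const | exact HM].
    exists 0. intros x _. apply pow2_ge_0. }
  apply Rle_antisym; [| exact HM0]. apply Rnot_lt_le. intros Hpos.
  assert (Hm : 0 < M / 2) by lra.
  destruct (proj1 (filterlim_locally _ M) HM (mkposreal _ Hm)) as [N1 H1].
  (* Both ends of the unit interval lie within this radius of [l], so the squared increment is below
     [M / 2]; by the mean value theorem it is also a value of f'^2, hence above [M / 2]. *)
  assert (Hr : 0 < sqrt (M / 2) / 2) by (assert (A := sqrt_lt_R0 _ Hm); lra).
  destruct (proj1 (filterlim_locally f l) Hl (mkposreal _ Hr)) as [N2 H2].
  set (y := Rmin 0 (Rmin N1 N2) - 1).
  assert (Hy : y < 0 /\ y < N1 /\ y < N2).
  { assert (A := Rmin_l 0 (Rmin N1 N2)). assert (B := Rmin_r 0 (Rmin N1 N2)).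
    assert (C := Rmin_l N1 N2). assert (D := Rmin_r N1 N2). unfold y. lra. }
  destruct (MVT_gen f (y - 1) y (Derive f)) as [z [Hz Ez]].
  - intros z Hz. rewrite Rmin_left, Rmax_right in Hz by lra.
    apply Derive_correct, Hd. lra.
  - intros z Hz. rewrite Rmin_left, Rmax_right in Hz by lra.
    apply continuity_pt_filterlim, (ex_derive_continuous f), Hd. lra.
  - rewrite Rmin_left, Rmax_right in Hz by lra.
    assert (A := H1 z ltac:(lra)). assert (B := H2 y ltac:(lra)).
    assert (C := H2 (y - 1) ltac:(lra)).
    unfold ball in A, B, C; simpl in A, B, C;
      unfold AbsRing_ball, abs, minus, plus, opp in A, B, C; simpl in A, B, C.
    apply Rabs_def2 in A. apply Rabs_def2 in B. apply Rabs_def2 in C.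
    replace (Derive f z) with (f y - f (y - 1)) in A by lra.
    assert (S := sqrt_sqrt (M / 2) (Rlt_le _ _ Hm)).
    set (s := sqrt (M / 2)) in *.
    assert (- s < f y - f (y - 1) < s) by lra.
    nra.
Qed.

(** Poisson's equation times 2 phi' is exact, because rho phi' = rho h(rho) rho' is the derivative
    of -(c^2 / rho + kappa rho). *)
Lemma wave_energy (kappa c : R) (rho v phi : R -> R) :
  peaked_solitary_wave kappa c rho v phi ->
  forall x, x < 0 ->
    Derive phi x ^ 2
      = 2 * (exp (phi x) - 1 + c ^ 2 * (1 / rho x - 1) + kappa * (rho x - 1)).
Proof.
  intros W.
  set (G := fun x =>
    2 * (exp (phi x) - 1 + c ^ 2 * (1 / rho x - 1) + kappa * (rho x - 1))).
  assert (HG : is_lim G m_infty 0).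
  { assert (Lr := psw_far_rho _ _ _ _ _ W). assert (Lp := psw_far_phi _ _ _ _ _ W).
    apply (is_lim_eq _ _
      (2 * (exp 0 - 1 + c ^ 2 * (1 / 1 - 1) + kappa * (1 - 1))));
      [rewrite exp_0; field |].
    apply is_lim_mult_finite; [apply is_lim_const |].
    repeat first [apply is_lim_plus' | apply is_lim_minus' | apply is_lim_const
      | exact Lr | apply is_lim_div_finite; [lra | |] | apply is_lim_mult_finite].
    apply is_lim_comp_continuous; [exact Lp | apply continuous_exp]. }
  set (F := fun x => Derive phi x ^ 2 - G x).
  assert (HF : forall x, x < 0 -> is_derive F x 0).
  { intros x Hx. unfold F, G.
    assert (Hx0 : x <> 0) by lra.
    assert (Ep := wave_Derive_potential _ _ _ _ _ W x Hx0).
    destruct (psw_eqs _ _ _ _ _ W x Hx0) as [Hp Hr _ Hf Hf2 _ _ Hpo].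
    auto_derive; [repeat split; first [assumption | lra] |].
    change (fun x => rho x) with rho. change (fun x => phi x) with phi.
    change (fun x => Derive phi x) with (Derive phi).
    replace (Derive (Derive phi) x) with (exp (phi x) - rho x) by lra.
    rewrite Ep. unfold h. field. lra. }
  assert (HK : forall x, x < 0 -> F x = F (-1)).
  { intros x Hx. apply Derive_0_constant; [exact HF | exact Hx | lra]. }
  (* The conserved constant [F (-1)] is the limit of phi'^2 at minus infinity, which must be 0 as
     [phi] converges. *)
  assert (K0 : F (-1) = 0).
  { apply (Derive_sq_lim_m_infty phi 0).
    - intros x Hx. apply (psw_eqs _ _ _ _ _ W x). lra.
    - apply (psw_far_phi _ _ _ _ _ W).
    - apply is_lim_ext_loc with (fun x => F (-1) + G x).
      + exists 0. intros x Hx. rewrite <- (HK x Hx). unfold F. ring.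
      + apply (is_lim_eq _ _ (F (-1) + 0)); [ring |].
        apply is_lim_plus'; [apply is_lim_const | exact HG]. }
  intros x Hx. assert (A := HK x Hx). rewrite K0 in A. unfold F in A.
  change (Derive phi x ^ 2 = G x). lra.
Qed.

(** * Fractional powers and the constant [A0] *)

Lemma Rpower_cube_root_div (u a : R) :
  0 < u -> 0 < a -> Rpower (u ^ 3 / a) (1 / 3) = u / Rpower a (1 / 3).
Proof.
  intros Hu Ha. unfold Rpower. rewrite ln_div, ln_pow by (try apply pow_lt; assumption).
  change (u / exp (1 / 3 * ln a)) with (u * / exp (1 / 3 * ln a)).
  rewrite <- exp_Ropp.
  rewrite <- (exp_ln u Hu) at 2. rewrite <- exp_plus. f_equal. simpl. field.
Qed.

Lemma Rpower_third_pow (a : R) (n : nat) : Rpower a (INR n / 3) = Rpower a (1 / 3) ^ n.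
Proof.
  rewrite <- Rpower_pow by apply exp_pos. rewrite Rpower_mult. f_equal. field.
Qed.

Lemma continuous_Rpower (y a : R) : 0 < a -> continuous (fun x => Rpower x y) a.
Proof.
  intros Ha. apply (ex_derive_continuous (fun x => Rpower x y)).
  eexists. apply is_derive_Reals, derivable_pt_lim_power, Ha.
Qed.

Lemma cube_inj (x y : R) : 0 < x -> 0 < y -> x ^ 3 = y ^ 3 -> x = y.
Proof.
  intros Hx Hy E. apply Rmult_eq_reg_l with (x ^ 2 + x * y + y ^ 2); nra.
Qed.

(** Later [q] is the limit of u / |xi|^(1/3), and all constants of the pressureless case become
    monomials in [q]. Comparing cubes removes the fractional exponent: both are 81 c^2 / 32. *)
Lemma A0_eq (c q : R) :
  0 < c -> 0 < q -> q ^ 6 = 9 / 8 * sqrt 2 * c -> A0 c = q ^ 4.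
Proof.
  intros Hc Hq E. unfold A0.
  assert (Hr : 0 < 3 * sqrt (c / 2)).
  { assert (0 < sqrt (c / 2)) by (apply sqrt_lt_R0; lra). lra. }
  apply cube_inj.
  - assert (0 < Rpower (3 * sqrt (c / 2)) (4 / 3)) by apply exp_pos. lra.
  - apply pow_lt, Hq.
  - replace 4 with (INR 4) by (simpl; ring). rewrite Rpower_third_pow.
    set (p := Rpower (3 * sqrt (c / 2)) (1 / 3)).
    assert (Ep : p ^ 3 = 3 * sqrt (c / 2)).
    { unfold p. rewrite <- Rpower_third_pow.
      replace (INR 3 / 3) with 1 by (simpl; field). apply Rpower_1, Hr. }
    assert (S1 : sqrt (c / 2) * sqrt (c / 2) = c / 2) by (apply sqrt_sqrt; lra).
    assert (S2 : sqrt 2 * sqrt 2 = 2) by (apply sqrt_sqrt; lra).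
    replace ((q ^ 4) ^ 3) with (q ^ 6 * q ^ 6) by ring. rewrite E.
    replace ((1 / 2 * p ^ 4) ^ 3) with (1 / 8 * (p ^ 3 * p ^ 3 * (p ^ 3 * p ^ 3)))
      by field.
    rewrite Ep.
    replace (3 * sqrt (c / 2) * (3 * sqrt (c / 2))) with (9 * (c / 2)) by nra.
    replace (9 / 8 * sqrt 2 * c * (9 / 8 * sqrt 2 * c))
      with (81 / 64 * (sqrt 2 * sqrt 2) * (c * c)) by field.
    rewrite S2. field.
Qed.

(** * Expansion at the peak for [kappa = 0] *)

(** Without pressure [h] is c^2 / r^3, which has no zero, so a finite supremum of the density would
    contradict criticality at the peak. *)
Lemma pressureless_peak (c : R) (rho v phi : R -> R) :
  0 < c -> peaked_solitary_wave 0 c rho v phi ->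
  is_lim rho 0 p_infty /\ sup_off0 v = Finite c /\ sup_off0 phi = Finite (c ^ 2 / 2).
Proof.
  intros Hc W.
  destruct (wave_sup_lim _ _ _ _ _ W) as [Lr [Lv Lp]].
  assert (Einf : sup_off0 rho = p_infty).
  { destruct (sup_off0 rho) as [r | |] eqn:Er; [| reflexivity |].
    - destruct (wave_critical_at_peak _ _ r _ _ _ W Er) as [Hr Hh].
      exfalso. unfold h in Hh.
      assert (0 < c ^ 2 / r ^ 3) by (apply Rdiv_lt_0_compat; apply pow_lt; assumption).
      unfold Rdiv at 2 in Hh. lra.
    - assert (A := sup_off0_ge rho (-1)). rewrite Er in A. destruct A. lra. }
  rewrite Einf in Lr.
  assert (Linv : is_lim (fun x => / rho x) 0 0).
  { apply (is_lim_inv rho 0 p_infty Lr). discriminate. }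
  split; [exact Lr |]. split.
  - apply is_lim_unique in Lv. rewrite <- Lv. apply is_lim_unique.
    apply is_lim_ext_ne0 with (fun x => c - c * / rho x).
    + intros x Hx. symmetry. apply (wave_velocity _ _ _ _ _ W x Hx).
    + apply (is_lim_eq _ _ (c - c * 0)); [ring |].
      apply is_lim_minus'; [apply is_lim_const |].
      apply is_lim_mult_finite; [apply is_lim_const | exact Linv].
  - apply is_lim_unique in Lp. rewrite <- Lp. apply is_lim_unique.
    apply is_lim_ext_ne0 with (fun x => c ^ 2 / 2 * (1 - / rho x * / rho x)).
    + intros x Hx. rewrite (wave_potential _ _ _ _ _ W x Hx). unfold bernoulli.
      assert (A := wave_pos _ _ _ _ _ W x Hx). field. lra.
    + apply (is_lim_eq _ _ (c ^ 2 / 2 * (1 - 0 * 0))); [field |].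
      apply is_lim_mult_finite; [apply is_lim_const |].
      apply is_lim_minus'; [apply is_lim_const |].
      apply is_lim_mult_finite; exact Linv.
Qed.

Lemma pressureless_gap (c : R) (rho v phi : R -> R) :
  peaked_solitary_wave 0 c rho v phi ->
  forall x, x <> 0 -> c ^ 2 / 2 - phi x = c ^ 2 / (2 * rho x ^ 2).
Proof.
  intros W x Hx. rewrite (wave_potential _ _ _ _ _ W x Hx).
  assert (A := wave_pos _ _ _ _ _ W x Hx). unfold bernoulli. field. lra.
Qed.

(* The fourth root of [phi* - phi], the natural variable near the peak:
   the energy identity gives [phi' ~ K u] and hence [(u^3)' -> - 3/4 K]. *)
Definition quartic_gap (c : R) (phi : R -> R) (x : R) : R :=
  sqrt (sqrt (c ^ 2 / 2 - phi x)).

Lemma quartic_gap_pos (c : R) (rho v phi : R -> R) :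
  0 < c -> peaked_solitary_wave 0 c rho v phi ->
  forall x, x <> 0 -> 0 < quartic_gap c phi x.
Proof.
  intros Hc W x Hx. apply sqrt_lt_R0, sqrt_lt_R0.
  rewrite (pressureless_gap _ _ _ _ W x Hx).
  assert (A := wave_pos _ _ _ _ _ W x Hx). apply Rdiv_lt_0_compat; nra.
Qed.

Lemma quartic_gap_pow2 (c : R) (rho v phi : R -> R) :
  0 < c -> peaked_solitary_wave 0 c rho v phi ->
  forall x, x <> 0 -> sqrt 2 * quartic_gap c phi x ^ 2 = c / rho x.
Proof.
  intros Hc W x Hx. assert (A := wave_pos _ _ _ _ _ W x Hx).
  unfold quartic_gap. rewrite pow2_sqrt by apply sqrt_pos.
  rewrite (pressureless_gap _ _ _ _ W x Hx), <- sqrt_mult_alt by lra.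
  rewrite <- (sqrt_pow2 (c / rho x)).
  - f_equal. field. lra.
  - apply Rlt_le, Rdiv_lt_0_compat; assumption.
Qed.

Lemma quartic_gap_pow4 (c : R) (rho v phi : R -> R) :
  0 < c -> peaked_solitary_wave 0 c rho v phi ->
  forall x, x <> 0 -> quartic_gap c phi x ^ 4 = c ^ 2 / 2 - phi x.
Proof.
  intros Hc W x Hx. assert (A := wave_pos _ _ _ _ _ W x Hx).
  assert (E := quartic_gap_pow2 _ _ _ _ Hc W x Hx).
  rewrite (pressureless_gap _ _ _ _ W x Hx).
  assert (S2 : sqrt 2 * sqrt 2 = 2) by (apply sqrt_sqrt; lra).
  set (u := quartic_gap c phi x) in *.
  replace (c ^ 2 / (2 * rho x ^ 2)) with (/ 2 * (c / rho x) ^ 2) by (field; lra).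
  rewrite <- E.
  replace (/ 2 * (sqrt 2 * u ^ 2) ^ 2) with (/ 2 * (sqrt 2 * sqrt 2) * u ^ 4) by ring.
  rewrite S2. field.
Qed.

(** Makes the exponential terms of the energy of order u^4, negligible against the term of order
    u^2. *)
Lemma exp_diff_bound (x p : R) : x <= p -> 0 <= exp p - exp x <= exp p * (p - x).
Proof.
  intros H. assert (E : exp x = exp p * exp (x - p)).
  { rewrite <- exp_plus. f_equal. ring. }
  assert (A := exp_ineq1_le (x - p)). assert (P := exp_pos p).
  split.
  - assert (B : exp x <= exp p) by (destruct H as [H | ->];
      [apply Rlt_le, exp_increasing, H | lra]). lra.
  - rewrite E. nra.
Qed.

Lemma quartic_gap_lim (c : R) (rho v phi : R -> R) :
  0 < c -> peaked_solitary_wave 0 c rho v phi ->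
  is_lim (quartic_gap c phi) 0 0.
Proof.
  intros Hc W. destruct (pressureless_peak _ _ _ _ Hc W) as [_ [_ Ep]].
  destruct (wave_sup_lim _ _ _ _ _ W) as [_ [_ Lp]]. rewrite Ep in Lp.
  unfold quartic_gap.
  apply (is_lim_eq _ _ (sqrt (sqrt (c ^ 2 / 2 - c ^ 2 / 2)))).
  { rewrite Rminus_diag, !sqrt_0. reflexivity. }
  apply (is_lim_comp_continuous _ sqrt); [| apply continuous_sqrt].
  apply (is_lim_comp_continuous _ sqrt); [| apply continuous_sqrt].
  apply is_lim_minus'; [apply is_lim_const | exact Lp].
Qed.

Lemma pressureless_slope (c : R) (rho v phi : R -> R) :
  is_c 0 c -> peaked_solitary_wave 0 c rho v phi ->
  is_lim (fun x => Rabs (Derive phi x) / quartic_gap c phi x) 0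
    (sqrt (2 * sqrt 2 * c)).
Proof.
  intros Hc0 W. assert (Hc := is_c_pos 0 c Hc0).
  assert (Eexp : c ^ 2 + 1 = exp (c ^ 2 / 2)) by (destruct Hc0 as [[F _] | F]; lra).
  assert (Upos := quartic_gap_pos _ _ _ _ Hc W).
  assert (Lu := quartic_gap_lim _ _ _ _ Hc W).
  apply is_lim_ext_ne0 with (fun x =>
    sqrt (Rabs (Derive phi x) ^ 2 / quartic_gap c phi x ^ 2)).
  { intros x Hx. specialize (Upos x Hx).
    rewrite <- (sqrt_pow2 (Rabs (Derive phi x) / quartic_gap c phi x)).
    - f_equal. field. lra.
    - apply Rmult_le_pos; [apply Rabs_pos |].
      apply Rlt_le, Rinv_0_lt_compat, Upos. }
  apply (is_lim_comp_continuous _ sqrt); [| apply continuous_sqrt].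
  (* Since the constants cancel, phi'^2 / u^2 differs from [2 * sqrt 2 * c] only by the exponential
     difference over u^2, which is nonpositive and of order u^2. *)
  apply is_lim_le_le_loc with
    (f := fun x => 2 * sqrt 2 * c
            - 2 * exp (c ^ 2 / 2) * (quartic_gap c phi x * quartic_gap c phi x))
    (g := fun _ => 2 * sqrt 2 * c).
  - exists (mkposreal 1 Rlt_0_1). intros x _ Hx. change (x <> 0) in Hx.
    specialize (Upos x Hx).
    assert (En : Rabs (Derive phi x) ^ 2
              = 2 * (exp (phi x) - exp (c ^ 2 / 2)
                     + c * (sqrt 2 * quartic_gap c phi x ^ 2))).
    { rewrite (quartic_gap_pow2 _ _ _ _ Hc W x Hx), <- Eexp.
      assert (L : forall y, y < 0 -> Rabs (Derive phi y) ^ 2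
              = 2 * (exp (phi y) - (c ^ 2 + 1) + c * (c / rho y))).
      { intros y Hy. rewrite pow2_abs, (wave_energy _ _ _ _ _ W y Hy).
        assert (A := wave_pos _ _ _ _ _ W y). field. lra. }
      destruct (Rlt_or_le x 0) as [Hlt | Hle]; [exact (L x Hlt) |].
      rewrite (wave_Rabs_Derive_potential_even _ _ _ _ _ W x Hx).
      destruct (psw_even _ _ _ _ _ W x Hx) as [-> [_ ->]]. apply L. lra. }
    assert (Ew := quartic_gap_pow4 _ _ _ _ Hc W x Hx).
    set (u := quartic_gap c phi x) in *.
    assert (Hu4 : 0 < u ^ 4) by (apply pow_lt, Upos).
    assert (Hu2 : 0 < u ^ 2) by (apply pow_lt, Upos).
    destruct (exp_diff_bound (phi x) (c ^ 2 / 2)) as [B1 B2]; [lra |].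
    rewrite <- Ew in B2. rewrite En. split.
    + apply Rle_div_r; [exact Hu2 |].
      replace ((2 * sqrt 2 * c - 2 * exp (c ^ 2 / 2) * (u * u)) * u ^ 2)
        with (2 * (- (exp (c ^ 2 / 2) * u ^ 4) + c * (sqrt 2 * u ^ 2))) by ring.
      lra.
    + apply Rle_div_l; [exact Hu2 |]. lra.
  - apply (is_lim_eq _ _ (2 * sqrt 2 * c - 2 * exp (c ^ 2 / 2) * (0 * 0))); [ring |].
    apply is_lim_minus'; [apply is_lim_const |].
    apply is_lim_mult_finite; [apply is_lim_const |].
    apply is_lim_mult_finite; exact Lu.
  - apply is_lim_const.
Qed.

(** u^3 is the 3/4 power of the gap, so its derivative is -(3/4) phi' / u, whose limit is known;
    linear approximation from the left concludes. *)
Lemma quartic_gap_cube_lim (c : R) (rho v phi : R -> R) :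
  is_c 0 c -> peaked_solitary_wave 0 c rho v phi ->
  is_lim (fun x => quartic_gap c phi x ^ 3 / Rabs x) 0
    (3 / 4 * sqrt (2 * sqrt 2 * c)).
Proof.
  intros Hc0 W. assert (Hc := is_c_pos 0 c Hc0).
  assert (Upos := quartic_gap_pos _ _ _ _ Hc W).
  assert (Lu := quartic_gap_lim _ _ _ _ Hc W).
  assert (LK := pressureless_slope _ _ _ _ Hc0 W).
  set (K := sqrt (2 * sqrt 2 * c)) in *.
  apply is_lim_even_of_left with
    (fun x => - ((0 - quartic_gap c phi x ^ 3) / - x)).
  - intros x Hx. unfold quartic_gap. rewrite Rabs_Ropp.
    destruct (psw_even _ _ _ _ _ W x Hx) as [_ [_ <-]]. reflexivity.
  - intros x Hx. rewrite Rabs_left by exact Hx. field. lra.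
  - replace (Finite (3 / 4 * K)) with (Rbar_opp (- (3 / 4 * K)))
      by (simpl; f_equal; ring).
    eapply filterlim_comp; [| apply filterlim_Rbar_opp].
    apply left_linear_approx with
      (fun x => - (3 / 4 * (Rabs (Derive phi x) / quartic_gap c phi x))).
    + apply at_left_0_of_neg. intros x Hx.
      assert (Hx0 : x <> 0) by lra. specialize (Upos x Hx0).
      assert (Hd := tw_phi_diff _ _ _ _ _ _ (psw_eqs _ _ _ _ _ W x Hx0)).
      rewrite Rabs_right by (apply Rle_ge, Rlt_le, (psw_incr _ _ _ _ _ W x Hx)).
      unfold quartic_gap in *.
      assert (G : 0 < c ^ 2 / 2 - phi x).
      { rewrite (pressureless_gap _ _ _ _ W x Hx0).
        assert (A := wave_pos _ _ _ _ _ W x Hx0). apply Rdiv_lt_0_compat; nra. }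
      assert (G2 := sqrt_lt_R0 _ G).
      auto_derive; [repeat split; assumption |].
      change (fun x => phi x) with phi.
      set (w := c ^ 2 / 2 - phi x) in *.
      change (c * (c * 1) / 2 + - phi x) with w. assert (S := sqrt_sqrt _ (Rlt_le _ _ G2)).
      set (b := sqrt (sqrt w)) in *. rewrite <- S. field. lra.
    + apply (is_lim_at_left _ 0).
      apply is_lim_ext with (fun x =>
        quartic_gap c phi x * (quartic_gap c phi x * quartic_gap c phi x));
        [intros x; ring |].
      apply (is_lim_eq _ _ (0 * (0 * 0))); [ring |].
      repeat apply is_lim_mult_finite; exact Lu.
    + apply (is_lim_at_left _ (- (3 / 4 * K))).
      apply (is_lim_opp _ 0 (3 / 4 * K)).
      apply is_lim_mult_finite; [apply is_lim_const | exact LK].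
Qed.

Lemma is_lim_pow (f : R -> R) (x : Rbar) (l : R) (n : nat) :
  is_lim f x l -> is_lim (fun y => f y ^ n) x (l ^ n).
Proof.
  intros H. induction n as [| n IH]; [apply is_lim_const |].
  apply (is_lim_mult_finite f (fun y => f y ^ n)); assumption.
Qed.

(** Everything is a function of u / |xi|^(1/3), which tends to [q]: the gap of [phi] is u^4, phi' is
    asymptotic to K u, and the velocity gap c / rho is sqrt 2 u^2. *)
Lemma peaked_wave_pressureless (c : R) (rho v phi : R -> R) :
  is_c 0 c -> peaked_solitary_wave 0 c rho v phi ->
    is_finite (sup_off0 v) /\
    is_finite (sup_off0 phi) /\
    is_lim (fun xi => (real (sup_off0 phi) - phi xi) / Rpower (Rabs xi) (4 / 3))
      0 (A0 c) /\
    is_lim (fun xi => Rabs (Derive phi xi) / Rpower (Rabs xi) (1 / 3))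
      0 (4 / 3 * A0 c) /\
    is_lim (fun xi => Rabs (Derive (Derive phi) xi) * Rpower (Rabs xi) (2 / 3))
      0 (4 / 9 * A0 c) /\
    is_lim (fun xi => rho xi * Rpower (Rabs xi) (2 / 3))
      0 (4 / 9 * A0 c) /\
    is_lim (fun xi => (real (sup_off0 v) - v xi) / Rpower (Rabs xi) (2 / 3))
      0 (sqrt (2 * A0 c)).
Proof.
  intros Hc0 W. assert (Hc := is_c_pos 0 c Hc0).
  destruct (pressureless_peak _ _ _ _ Hc W) as [Lr [Ev Ep]].
  destruct (wave_sup_lim _ _ _ _ _ W) as [_ [_ Lp]]. rewrite Ep in Lp.
  rewrite Ev, Ep. cbn [real].
  assert (Upos := quartic_gap_pos _ _ _ _ Hc W).
  assert (U2 := quartic_gap_pow2 _ _ _ _ Hc W).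
  assert (U4 := quartic_gap_pow4 _ _ _ _ Hc W).
  assert (LK := pressureless_slope _ _ _ _ Hc0 W).
  assert (L3 := quartic_gap_cube_lim _ _ _ _ Hc0 W).
  assert (Hpos := wave_pos _ _ _ _ _ W).
  assert (S2 : sqrt 2 * sqrt 2 = 2) by (apply sqrt_sqrt; lra).
  assert (H2 : 0 < sqrt 2) by (apply sqrt_lt_R0; lra).
  assert (HK0 : 0 < 2 * sqrt 2 * c) by (apply Rmult_lt_0_compat; lra).
  assert (HK := sqrt_lt_R0 _ HK0).
  assert (HKK := sqrt_sqrt _ (Rlt_le _ _ HK0)).
  set (u := quartic_gap c phi) in *. set (K := sqrt (2 * sqrt 2 * c)) in *.
  set (t := fun x => Rpower (Rabs x) (1 / 3)).
  assert (Tpos : forall x, 0 < t x) by (intros x; apply exp_pos).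
  assert (T2 : forall x, Rpower (Rabs x) (2 / 3) = t x ^ 2).
  { intros x. unfold t. rewrite <- Rpower_third_pow. reflexivity. }
  assert (T4 : forall x, Rpower (Rabs x) (4 / 3) = t x ^ 4).
  { intros x. unfold t. rewrite <- Rpower_third_pow. f_equal. simpl. field. }
  set (q := Rpower (3 / 4 * K) (1 / 3)).
  assert (Hq : 0 < q) by apply exp_pos.
  assert (Hq3 : q ^ 3 = 3 / 4 * K).
  { unfold q. rewrite <- Rpower_third_pow.
    replace (INR 3 / 3) with 1 by (simpl; field). apply Rpower_1. lra. }
  assert (Hq6 : q ^ 6 = 9 / 8 * sqrt 2 * c).
  { replace (q ^ 6) with (q ^ 3 * q ^ 3) by ring. rewrite Hq3.
    replace (3 / 4 * K * (3 / 4 * K)) with (9 / 16 * (K * K)) by field.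
    rewrite HKK. field. }
  rewrite (A0_eq c q Hc Hq Hq6).
  assert (Lq : is_lim (fun x => u x / t x) 0 q).
  { apply is_lim_ext_ne0 with (fun x => Rpower (u x ^ 3 / Rabs x) (1 / 3)).
    - intros x Hx. apply Rpower_cube_root_div; [apply Upos, Hx | apply Rabs_pos_lt, Hx].
    - apply (is_lim_comp_continuous _ (fun y => Rpower y (1 / 3))); [exact L3 |].
      apply continuous_Rpower. lra. }
  assert (Lrho : is_lim (fun x => rho x * t x ^ 2) 0 (4 / 9 * q ^ 4)).
  { apply is_lim_ext_ne0 with (fun x => c / (sqrt 2 * (u x / t x) ^ 2)).
    - intros x Hx. specialize (Upos x Hx). specialize (Tpos x). specialize (Hpos x Hx).
      replace (sqrt 2 * (u x / t x) ^ 2) with (sqrt 2 * u x ^ 2 / t x ^ 2)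
        by (field; lra).
      rewrite (U2 x Hx). field. lra.
    - apply (is_lim_eq _ _ (c / (sqrt 2 * q ^ 2))).
      (* After clearing the denominator the claim is (4/9) sqrt 2 q^6 = c, which is [Hq6]. *)
      + assert (0 < q ^ 2) by (apply pow_lt, Hq).
        apply Rmult_eq_reg_r with (sqrt 2 * q ^ 2); [| nra].
        replace (c / (sqrt 2 * q ^ 2) * (sqrt 2 * q ^ 2)) with c by (field; lra).
        replace (4 / 9 * q ^ 4 * (sqrt 2 * q ^ 2)) with (4 / 9 * sqrt 2 * q ^ 6) by ring.
        rewrite Hq6.
        replace (4 / 9 * sqrt 2 * (9 / 8 * sqrt 2 * c))
          with (1 / 2 * (sqrt 2 * sqrt 2) * c) by field.
        rewrite S2. field.
      + apply is_lim_div_finite.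
        * assert (0 < q ^ 2) by (apply pow_lt, Hq). nra.
        * apply is_lim_const.
        * apply is_lim_mult_finite; [apply is_lim_const | apply is_lim_pow, Lq]. }
  repeat split.
  - apply is_lim_ext_ne0 with (fun x => (u x / t x) ^ 4).
    + intros x Hx. rewrite T4, <- (U4 x Hx). specialize (Tpos x). field. lra.
    + apply is_lim_pow, Lq.
  - apply is_lim_ext_ne0 with (fun x => Rabs (Derive phi x) / u x * (u x / t x)).
    + intros x Hx. fold (t x). specialize (Tpos x). specialize (Upos x Hx). field. lra.
    + apply (is_lim_eq _ _ (K * q)).
      * replace (4 / 3 * q ^ 4) with (4 / 3 * q ^ 3 * q) by ring. rewrite Hq3. field.
      * apply is_lim_mult_finite; assumption.
  - apply is_lim_ext_ne0 with (fun x => Rabs (exp (phi x) * t x ^ 2 - rho x * t x ^ 2)).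
    + intros x Hx. rewrite T2. specialize (Tpos x).
      assert (E := tw_poisson _ _ _ _ _ _ (psw_eqs _ _ _ _ _ W x Hx)).
      rewrite <- (Rabs_right (t x ^ 2)) at 3 by (apply Rle_ge, pow_le; lra).
      rewrite <- Rabs_mult. f_equal.
      replace (Derive (Derive phi) x) with (exp (phi x) - rho x) by lra. ring.
    + apply (is_lim_eq _ _ (Rabs (exp (c ^ 2 / 2) * (4 / 9 * q ^ 4 * 0) - 4 / 9 * q ^ 4))).
      * rewrite Rmult_0_r, Rmult_0_r, Rminus_0_l, Rabs_Ropp.
        apply Rabs_right, Rle_ge. assert (0 < q ^ 4) by (apply pow_lt, Hq). lra.
      * apply (is_lim_Rabs _ 0
          (Finite (exp (c ^ 2 / 2) * (4 / 9 * q ^ 4 * 0) - 4 / 9 * q ^ 4))).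
        apply is_lim_minus'; [| exact Lrho].
        (* That [t x ^ 2] tends to 0 is read off from the limit of [rho x * t x ^ 2] and the blow-up
           of [rho]. *)
        apply is_lim_ext_ne0 with (fun x => exp (phi x) * (rho x * t x ^ 2 * / rho x)).
        -- intros x Hx. specialize (Hpos x Hx). field. lra.
        -- apply is_lim_mult_finite.
           ++ apply is_lim_comp_continuous; [exact Lp | apply continuous_exp].
           ++ apply is_lim_mult_finite; [exact Lrho |].
              apply (is_lim_inv rho 0 p_infty Lr). discriminate.
  - apply is_lim_ext_ne0 with (fun x => rho x * t x ^ 2); [| exact Lrho].
    intros x Hx. rewrite T2. reflexivity.
  - apply is_lim_ext_ne0 with (fun x => sqrt 2 * (u x / t x) ^ 2).
    + intros x Hx. rewrite T2, (wave_velocity _ _ _ _ _ W x Hx).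
      specialize (Tpos x).
      replace (c - (c - c / rho x)) with (c / rho x) by ring.
      rewrite <- (U2 x Hx). field. lra.
    + apply (is_lim_eq _ _ (sqrt 2 * q ^ 2)).
      * rewrite sqrt_mult_alt by lra. f_equal.
        replace (q ^ 4) with ((q ^ 2) ^ 2) by ring. symmetry. apply sqrt_pow2.
        apply pow_le. lra.
      * apply is_lim_mult_finite; [apply is_lim_const | apply is_lim_pow, Lq].
Qed.

Theorem theorem1p2 :
  forall (kappa c : R) (rho v phi : R -> R),
    0 <= kappa ->
    is_c kappa c ->
    peaked_solitary_wave kappa c rho v phi ->
    (kappa = 0 ->
       is_finite (sup_off0 v) /\
       is_finite (sup_off0 phi) /\
       is_lim (fun xi => (real (sup_off0 phi) - phi xi) / Rpower (Rabs xi) (4 / 3))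
         0 (A0 c) /\
       is_lim (fun xi => Rabs (Derive phi xi) / Rpower (Rabs xi) (1 / 3))
         0 (4 / 3 * A0 c) /\
       is_lim (fun xi => Rabs (Derive (Derive phi) xi) * Rpower (Rabs xi) (2 / 3))
         0 (4 / 9 * A0 c) /\
       is_lim (fun xi => rho xi * Rpower (Rabs xi) (2 / 3))
         0 (4 / 9 * A0 c) /\
       is_lim (fun xi => (real (sup_off0 v) - v xi) / Rpower (Rabs xi) (2 / 3))
         0 (sqrt (2 * A0 c)))
    /\
    (0 < kappa ->
       is_finite (sup_off0 rho) /\
       is_finite (sup_off0 v) /\
       is_finite (sup_off0 phi) /\
       let rhos := real (sup_off0 rho) in
       let vs := real (sup_off0 v) in
       let phis := real (sup_off0 phi) in
       let L := 1 / 2 * (rhos - exp phis) in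
       let S := sqrt ((rhos - exp phis) / - Derive (h kappa c) rhos) in
       is_lim (fun xi => (phis - phi xi) / Rabs xi ^ 2) 0 L /\
       is_lim (fun xi => Rabs (Derive phi xi) / (2 * Rabs xi)) 0 L /\
       is_lim (fun xi => - Derive (Derive phi) xi / 2) 0 L /\
       0 < L /\
       Derive (h kappa c) rhos < 0 /\
       is_lim (fun xi => (rhos - rho xi) / Rabs xi) 0 S /\
       exists Lv : R,
         is_lim (fun xi => (vs - v xi) / Rabs xi) 0 Lv /\
         rhos ^ 2 / c * Lv = S).
Proof.
  intros kappa c rho v phi _ Hc W. split.
  - intros ->. exact (peaked_wave_pressureless c rho v phi Hc W).
  - intros Hk. exact (peaked_wave_pressure kappa c rho v phi Hk Hc W).
Qed.
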